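(* Let $1<p<\infty$ and let $w\in A_p^{\mathcal{D}}$ be a weight on $\mathbb{R}$. For all $\Lambda>1$, $$\sup_{\mathcal{S}}\frac{\|\mathcal{A}_{\mathcal{S}}:L^p(w)\to L^p(w)\|}{\Lambda}\le\sup_{b}\frac{\|\Pi_b:L^p(w)\to L^p(w)\|}{\|b\|_{BMO^{\mathcal{D}}}}+\sup_{b}\frac{\|\Pi_b^*:L^p(w)\to L^p(w)\|}{\|b\|_{BMO^{\mathcal{D}}}}+\sup_{\tau}\frac{\|T_\tau:L^p(w)\to L^p(w)\|}{\|\tau\|_\infty},$$ where the supremum on the left is over all sparse collections $\mathcal{S}\subset\mathcal{D}$ with Carleson constant $\Lambda$ and no infinitely increasing chains, the suprema over $b$ are over all $b\in BMO^{\mathcal{D}}(\mathbb{R})$ with $\|b\|_{BMO^{\mathcal{D}}}\ne0$, and the supremum over $\tau$ is over all nonzero bounded sequences $\tau=\{\tau_J\}_{J\in\mathcal{D}}$.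
   Context: $\mathcal{D}$ is a fixed dyadic grid on $\mathbb{R}$: a collection of intervals of lengths $2^k$, $k\in\mathbb{Z}$, such that for each fixed $k$ those of length $2^k$ partition $\mathbb{R}$, and $I\cap J\in\{I,J,\emptyset\}$ for all $I,J\in\mathcal{D}$. $\mathcal{S}\subset\mathcal{D}$ has Carleson constant $\Lambda>1$ (is $\Lambda$-Carleson) if $\sum_{I\in\mathcal{S},I\subset J}|I|\le\Lambda|J|$ for all $J\in\mathcal{D}$; it is sparse if it is $\Lambda$-Carleson for some $\Lambda>1$. $\mathcal{S}$ has an infinitely increasing chain if there are $I_k\in\mathcal{S}$, $k\in\mathbb{N}$, with $I_k\subsetneq I_{k+1}$ for all $k$. $h_I=|I|^{-1/2}(\mathbf{1}_{I_+}-\mathbf{1}_{I_-})$ with $I_+,I_-$ the right and left halves of $I$; $(f,g)=\int fg\,dx$; $\langle f\rangle_I=\frac1{|I|}\int_If\,dx$. A weight is a locally integrable, a.e. positive function; $L^p(w)$ is $L^p$ of the measure $w\,dx$. With $1/p+1/p'=1$, $w'=w^{1-p'}$, $w\in A_p^{\mathcal{D}}$ means $\sup_{I\in\mathcal{D}}\langle w\rangle_I\langle w'\rangle_I^{p-1}<\infty$. $\|b\|_{BMO^{\mathcal{D}}}=\sup_{I\in\mathcal{D}}\frac1{|I|}\int_I|b-\langle b\rangle_I|\,dx$. Operators: $\mathcal{A}_{\mathcal{S}}f=\sum_{I\in\mathcal{S}}\langle f\rangle_I\mathbf{1}_I$; $\Pi_bf=\sum_{I\in\mathcal{D}}(b,h_I)\langle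 f\rangle_Ih_I$; $\Pi_b^*f=\sum_{I\in\mathcal{D}}(b,h_I)(f,h_I)\frac{\mathbf{1}_I}{|I|}$; $T_\tau f=\sum_{J\in\mathcal{D}}\tau_J(f,h_J)h_J$ (martingale transform), with $\|\tau\|_\infty=\sup_J|\tau_J|$. $\|T:X\to Y\|$ is the operator norm. *)

(* Defs.v *)
From HB Require Import structures.
From mathcomp Require Import all_boot all_order all_algebra.
From mathcomp Require Import all_classical all_reals all_analysis.
From mathcomp Require Import measurable_realfun.

Set Implicit Arguments.
Unset Strict Implicit.
Unset Printing Implicit Defensive.

Import Order.TTheory GRing.Theory Num.Theory.
Import numFieldNormedType.Exports.

Local Open Scope classical_set_scope.
Local Open Scope ring_scope.

Notation leb := lebesgue_measure.

Section dyadic.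
Context {R : realType}.
Implicit Types (D S : set (set R)) (I J : set R).

(* The intervals may be open, closed or half-open. *)
Definition dyadic_interval (k : int) I :=
  is_interval I /\ leb I = (2 ^ k)%:E.

Definition dyadic_grid D :=
  [/\ forall I, D I -> exists k, dyadic_interval k I,
      forall k, partition [set I | D I /\ dyadic_interval k I] id [set: R] &
      forall I J, D I -> D J ->
        [\/ I `&` J = I, I `&` J = J | I `&` J = set0]].

Definition carleson D (Lambda : R) S :=
  forall J, D J ->
    (\esum_(I in [set I | S I /\ I `<=` J]) leb I <= Lambda%:E * leb J)%E.

Definition infinitely_increasing_chain S :=
  exists I_ : nat -> set R, forall k, S (I_ k) /\ I_ k `<` I_ k.+1.

Definition len I : R := fine (leb I).

Definition midpoint I : R := (inf I + sup I) / 2.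

(* The midpoint is put in the right half; this choice only affects [haar] on
   a null set. *)
Definition right_half I : set R := I `&` [set x | midpoint I <= x].
Definition left_half I : set R := I `&` [set x | x < midpoint I].

Definition haar I (x : R) : R :=
  (Num.sqrt (len I))^-1 * (\1_(right_half I) x - \1_(left_half I) x).

Definition pairing (f g : R -> R) : R := \int[leb]_x (f x * g x).

Definition average (f : R -> R) I : R := (\int[leb]_(x in I) f x) / len I.

Definition bmo_norm D (b : R -> R) : \bar R :=
  ereal_sup [set ((\int[leb]_(x in I) `|b x - average b I|%:E) / leb I)%E
            | I in D].

Definition BMO D (b : R -> R) :=
  locally_integrable [set: R] b /\ (bmo_norm D b < +oo)%E.

Definition sup_norm D (tau : set R -> R) : \bar R :=
  ereal_sup [set `|tau J|%:E | J in D].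

End dyadic.

Record weight (R : realType) := Weight {
  weight_fun :> R -> R ;
  weight_locally_integrable : locally_integrable [set: R] weight_fun ;
  weight_ae_gt0 : {ae leb, forall x, 0 < weight_fun x} }.

Section weighted_measure.
Context {R : realType} (w : weight R).

(* The measure w dx. As w > 0 almost everywhere, the absolute value changes
   nothing; it makes the set function nonnegative by construction. *)
Definition weight_measure (A : set R) : \bar R :=
  (\int[leb]_(x in A) `|w x|%:E)%E.

Let weight_measure0 : weight_measure set0 = 0%E.
Proof. by rewrite /weight_measure integral_set0. Qed.

Let weight_measure_ge0 A : (0 <= weight_measure A)%E.
Proof. by apply: integral_ge0 => x _; rewrite lee_fin. Qed.

Let weight_measure_sigma_additive : semi_sigma_additive weight_measure.
Proof.
move=> F mF tF mUF; rewrite /weight_measure ge0_integral_bigcup//.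
  apply: is_cvg_ereal_nneg_natsum_cond => n _ _.
  by apply: integral_ge0 => x _; rewrite lee_fin.
have [mw _ _] := weight_locally_integrable w.
apply/measurable_EFinP; apply: measurable_funTS.
exact: measurableT_comp.
Qed.

HB.instance Definition _ := isMeasure.Build _ _ _ weight_measure
  weight_measure0 weight_measure_ge0 weight_measure_sigma_additive.

End weighted_measure.

Section muckenhoupt.
Context {R : realType}.

Definition conjugate_exponent (p : R) : R := p / (p - 1).

Definition dual_weight (p : R) (w : R -> R) (x : R) : R :=
  w x `^ (1 - conjugate_exponent p).

(* The averages are extended-real valued: the dual weight is not assumed to be
   locally integrable. *)
Definition Ap_weight (D : set (set R)) (p : R) (w : weight R) :=
  (ereal_sup [set ((\int[leb]_(x in I) (w x)%:E) / leb I *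
     ((\int[leb]_(x in I) (dual_weight p w x)%:E) / leb I) `^ (p - 1))%E
     | I in D] < +oo)%E.

End muckenhoupt.

Section operators.
Context {R : realType}.
Implicit Types (w : weight R) (p : R) (D S : set (set R)) (f g b : R -> R).

Definition Lp_norm w p f : \bar R := 'N[weight_measure w]_(p%:E)[EFin \o f].

Definition Lp w p : set (R -> R) :=
  [set f | f \in Lfun (weight_measure w) p%:E].

(* g is the sum of the series of the u I, I in A, converging unconditionally
   in L^p(w), that is, along the net of finite subsets of A. *)
Definition Lp_sum w p (A : set (set R)) (u : set R -> R -> R) g :=
  Lp w p g /\
  forall e : R, 0 < e -> exists2 F0, fsets A F0 &
    forall F, fsets A F -> F0 `<=` F ->
      (Lp_norm w p (fun x => (g x - \sum_(I \in F) u I x)%R) < e%:E)%E.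

(* An operator is given by its graph, [T f g] meaning that T f is defined and
   equal to g (almost everywhere). The norm is +oo unless T is defined on all
   of L^p(w), with values in L^p(w), and bounded. *)
Definition op_norm w p (T : (R -> R) -> (R -> R) -> Prop) : \bar R :=
  ereal_inf [set C%:E | C in [set C : R | 0 <= C /\
    forall f, Lp w p f -> exists g,
      [/\ Lp w p g, T f g & (Lp_norm w p g <= C%:E * Lp_norm w p f)%E]]].

Definition sparse_operator w p S f g :=
  Lp_sum w p S (fun I x => average f I * \1_I x) g.

Definition paraproduct w p D b f g :=
  Lp_sum w p D (fun I x => pairing b (haar I) * average f I * haar I x) g.

Definition adjoint_paraproduct w p D b f g :=
  Lp_sum w p D
    (fun I x => pairing b (haar I) * pairing f (haar I) * (\1_I x / len I)) g.

Definition martingale_transform w p D (tau : set R -> R) f g :=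
  Lp_sum w p D (fun J x => tau J * pairing f (haar J) * haar J x) g.

End operators.

(* Main.v *)
Require Import Defs.
From mathcomp Require Import all_boot all_order all_algebra.
From mathcomp Require Import all_classical all_reals all_analysis.
From mathcomp Require Import measurable_realfun ring lra.

Set Implicit Arguments.
Unset Strict Implicit.
Unset Printing Implicit Defensive.

Import Order.TTheory GRing.Theory Num.Theory.
Import numFieldNormedType.Exports.

Local Open Scope classical_set_scope.
Local Open Scope ring_scope.

(** For a finite collection [F] of dyadic intervals let [b] be the sum of the
    indicators of its members.  Then, almost everywhere,

      [A_F f = Pi_b f + Pi_b^* f + T_tau f],
      where [tau_J] is the sum of [|I| / |J|] over the [I] in [F] strictly
      contained in [J].

    Indeed [b f] is the sum of the two paraproducts and of the terms
    [<b>_J (f,h_J) h_J], whereas [f 1_I] is the sum of [<f>_I 1_I] and of the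
    terms [(f,h_J) h_J] with [J] contained in [I]; subtracting, the coefficient
    of [(f,h_J) h_J] that is left is the average of [b] over [J] less the number
    of members of [F] that contain [J], which is [tau_J].  If [F] has Carleson
    constant [Lambda], then [tau] is at most [Lambda] by definition
    ([sup_norm_inner_density]), and the mean oscillation of [b] is at most
    [Lambda] by a variance estimate ([bmo_norm_count_fun]).  Hence the norm of
    [A_F] is at most [Lambda] times the sum of the three suprema.

    The identity is proved one interval [I] at a time.  By the product rule for
    martingale differences, the [J]-th terms of the three series are the
    difference of two consecutive terms of the sequence
    [|I| / |J| <f>_J 1_J], where [J] runs through the ancestors of [I]
    ([product_term_parent]), so that their sum telescopes to [<f>_I 1_I] minus
    a remainder.  As averages over an interval are bounded on [L^p(w)] by the
    [A_p] condition ([Ap_average]), the remainder tends to zero, and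
    [finite_sparse_bound] follows.

    For infinite collections, finite subcollections have the same Carleson
    constant, so that the finite sums of the sparse operator are uniformly
    bounded; for nonnegative [f] they increase, and monotone and dominated
    convergence give unconditional convergence together with the same bound
    ([Lp_sum_nonneg], [sparse_operator_norm]). *)

(** Type class resolution does not see through the display of [lebesgue_measure]
    to find that its almost-everywhere sets form a filter. *)
#[local] Instance ae_leb_filter (R : realType) :
  Filter (nbhs (almost_everywhere (@lebesgue_measure R))).
Proof. exact: (ae_filter_ringOfSetsType lebesgue_measure). Qed.

Lemma ge0_neqy_EFin (R : realType) (x : \bar R) :
  (0 <= x)%E -> x != +oo%E -> exists a : R, x = a%:E.
Proof. by case: x => [a| |]// _ _; exists a. Qed.

(** * Weighted norms *)

Section weighted_norm.
Import HBNNSimple.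
Context {R : realType} (w : weight R).
Implicit Types (f g : R -> R) (p : R).

Lemma measurable_weight : measurable_fun [set: R] w.
Proof. by have [] := weight_locally_integrable w. Qed.

Lemma weight_measure_negligible (A : set R) :
  leb.-negligible A -> (weight_measure w).-negligible A.
Proof.
move=> [N [mN N0 AN]]; exists N; split => //.
rewrite /= /weight_measure null_set_integral//.
by apply/measurable_EFinP/measurable_funTS/measurableT_comp => //;
  exact: measurable_weight.
Qed.

Lemma ae_weight_measure (P : R -> Prop) :
  {ae leb, forall x, P x} -> {ae weight_measure w, forall x, P x}.
Proof. exact: weight_measure_negligible. Qed.

(** The weight is the density of [weight_measure]: for step functions this is
    the definition of the measure, and both sides commute with monotone
    limits. *)
Lemma integral_weight_measure (f : R -> \bar R) :
  (forall x, 0 <= f x)%E -> measurable_fun [set: R] f ->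
  (\int[weight_measure w]_x f x = \int[leb]_x (f x * `|w x|%:E))%E.
Proof.
move=> f0 mf.
pose h := nnsfun_approx measurableT mf.
have mw : measurable_fun [set: R] (fun x => `|w x|%:E).
  by apply/measurable_EFinP/measurableT_comp => //; exact: measurable_weight.
have hcvg x : (h n x)%:E @[n --> \oo] --> f x.
  by apply: (cvg_nnsfun_approx measurableT mf) => // t _; exact: f0.
have hnd x : {homo (fun n => (h n x)%:E) : m n / (m <= n)%N >-> (m <= n)%E}.
  by move=> m n mn; rewrite lee_fin; exact/lefP/nd_nnsfun_approx.
have mh n : measurable_fun [set: R] (fun x => (h n x)%:E).
  exact/measurable_EFinP/measurable_funP.
transitivity (limn (fun n => \int[weight_measure w]_x (h n x)%:E))%E.
  rewrite -monotone_convergence//; last by move=> n x _; rewrite lee_fin.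
  by apply: eq_integral => x _; apply/esym/cvg_lim => //; exact: hcvg.
transitivity (limn (fun n => \int[leb]_x ((h n x)%:E * `|w x|%:E)))%E; last first.
  rewrite -monotone_convergence//.
  - apply: eq_integral => x _; apply/cvg_lim => //; exact: cvgeZr.
  - by move=> n; apply: emeasurable_funM; [exact: mh|exact: mw].
  - by move=> n x _; rewrite mule_ge0 ?lee_fin.
  - by move=> x _ m n mn; rewrite lee_wpmul2r ?lee_fin//; exact: hnd.
suff intE n : (\int[weight_measure w]_x (h n x)%:E =
    \int[leb]_x ((h n x)%:E * `|w x|%:E))%E.
  by under eq_fun do rewrite intE.
have ind0 r x : (0 <= (r * \1_(h n @^-1` [set r]) x)%:E)%E.
  exact: nnfun_muleindic_ge0.
have mind r : measurable_fun [set: R]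
    (fun x => (r * \1_(h n @^-1` [set r]) x)%:E).
  by apply/measurable_EFinP/measurable_funM.
have hE x : (h n x)%:E =
    (\sum_(r \in range (h n)) (r * \1_(h n @^-1` [set r]) x)%:E)%E.
  by rewrite fsumEFin// -fimfunE.
transitivity (\int[leb]_x (\sum_(r \in range (h n))
    ((r * \1_(h n @^-1` [set r]) x)%:E * `|w x|%:E)))%E; last first.
  by apply: eq_integral => x _; rewrite hE ge0_mule_fsuml.
rewrite (eq_integral (fun x : R => (\sum_(r \in range (h n))
    (r * \1_(h n @^-1` [set r]) x)%:E)%E)); last by move=> x _; exact: hE.
rewrite !ge0_integral_fsum//; last 2 first.
- by move=> r; apply: emeasurable_funM; [exact: mind|exact: mw].
- by move=> r x _; apply: mule_ge0; [exact: ind0|rewrite lee_fin].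
apply: eq_fsbigr => r rh.
have r0 : 0 <= r by move: rh; rewrite inE => -[x _ <-].
under eq_integral do rewrite EFinM.
rewrite ge0_integralZl_EFin//; last exact/measurable_EFinP.
under [RHS]eq_integral do rewrite EFinM -muleA.
rewrite ge0_integralZl_EFin//; last first.
  apply: emeasurable_funM; last exact: mw.
  by apply/measurable_EFinP; exact: (measurable_indic (D := [set: R])).
congr (_ * _)%E.
rewrite integral_indic// setIT /= /weight_measure integral_mkcond.
by apply: eq_integral => x _; rewrite epatch_indic muleC.
Qed.

Lemma LpE p f : Lp w p f <->
  measurable_fun [set: R] f /\ (Lp_norm w p f < +oo)%E.
Proof.
rewrite /Lp /= inE; split => [/andP[]|[mf lf]]; first by rewrite !inE.
by apply/andP; rewrite !inE.
Qed.

Lemma Lp_norm_ge0 p f : (0 <= Lp_norm w p f)%E.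
Proof. exact: Lnorm_ge0. Qed.

Lemma Lp_norm_power p f : 0 < p ->
  (Lp_norm w p f `^ p = \int[weight_measure w]_x (`|f x| `^ p)%:E)%E.
Proof. by move=> p0; rewrite powR_Lnorm ?gt_eqF. Qed.

Lemma Lp_norm_root p f : 0 < p ->
  Lp_norm w p f = ((\int[weight_measure w]_x (`|f x| `^ p)%:E) `^ p^-1)%E.
Proof. by move=> p0; rewrite /Lp_norm unlock. Qed.

Lemma measurable_normr_powR p f : measurable_fun [set: R] f ->
  measurable_fun [set: R] (fun x => (`|f x| `^ p)%:E).
Proof.
move=> mf; apply/measurable_EFinP.
apply: (@measurableT_comp _ _ _ _ _ _ (@powR R ^~ p)) => //.
exact: measurableT_comp.
Qed.

Lemma Lp_norm_ae_le p f g : 0 < p ->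
  measurable_fun [set: R] f -> measurable_fun [set: R] g ->
  {ae weight_measure w, forall x, `|f x| <= `|g x|} ->
  (Lp_norm w p f <= Lp_norm w p g)%E.
Proof.
move=> p0 mf mg fg; rewrite (Lp_norm_root f p0) (Lp_norm_root g p0).
apply: gt0_ler_poweR; first by rewrite invr_ge0 ltW.
- by rewrite in_itv/= leey andbT; apply: integral_ge0 => x _; rewrite lee_fin powR_ge0.
- by rewrite in_itv/= leey andbT; apply: integral_ge0 => x _; rewrite lee_fin powR_ge0.
apply: ae_ge0_le_integral => //.
- exact: measurable_normr_powR.
- exact: measurable_normr_powR.
apply: filterS fg => x fgx _; rewrite lee_fin.
by apply: ge0_ler_powR => //; exact: ltW.
Qed.

Lemma Lp_norm_le p f g : 0 < p ->
  measurable_fun [set: R] f -> measurable_fun [set: R] g ->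
  (forall x, `|f x| <= `|g x|) -> (Lp_norm w p f <= Lp_norm w p g)%E.
Proof. by move=> p0 mf mg fg; apply: Lp_norm_ae_le => //; exact: aeW. Qed.

Lemma Lp_norm_ae_eq p f g : 0 < p ->
  measurable_fun [set: R] f -> measurable_fun [set: R] g ->
  {ae leb, forall x, f x = g x} -> Lp_norm w p f = Lp_norm w p g.
Proof.
move=> p0 mf mg /ae_weight_measure fg; apply/eqP; rewrite eq_le.
by apply/andP; split; apply: Lp_norm_ae_le => //; apply: filterS fg => x ->.
Qed.

Lemma Lp_norm0 p : 0 < p -> Lp_norm w p (fun=> 0) = 0%E.
Proof. by move=> p0; rewrite /Lp_norm (Lnorm0 (weight_measure w)) ?eqe ?gt_eqF. Qed.

Lemma Lp_normD p f g : 1 <= p ->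
  measurable_fun [set: R] f -> measurable_fun [set: R] g ->
  (Lp_norm w p (fun x => (f x + g x)%R) <= Lp_norm w p f + Lp_norm w p g)%E.
Proof. by move=> p1 mf mg; exact: minkowski_EFin. Qed.

Lemma Lp_normN p f : 0 < p -> Lp_norm w p (fun x => - f x) = Lp_norm w p f.
Proof.
move=> p0; rewrite (Lp_norm_root _ p0) (Lp_norm_root f p0).
by under eq_integral do rewrite normrN.
Qed.

Lemma Lp_normB p f g : 1 <= p ->
  measurable_fun [set: R] f -> measurable_fun [set: R] g ->
  (Lp_norm w p (fun x => (f x - g x)%R) <= Lp_norm w p f + Lp_norm w p g)%E.
Proof.
move=> p1 mf mg; rewrite -(Lp_normN g); last exact: lt_le_trans p1.
by apply: (Lp_normD (g := fun x => - g x)) => //; exact: measurableT_comp.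
Qed.

Lemma Lp_normZ p c f : 0 < p -> measurable_fun [set: R] f ->
  (Lp_norm w p (fun x => (c * f x)%R) = `|c|%:E * Lp_norm w p f)%E.
Proof.
move=> p0 mf; rewrite !Lp_norm_root//.
under eq_integral do rewrite normrM powRM// EFinM.
rewrite ge0_integralZl_EFin ?powR_ge0//; last exact: measurable_normr_powR.
rewrite poweRM ?lee_fin ?powR_ge0 ?integral_ge0//.
by rewrite poweR_EFin -powRrM mulfV ?gt_eqF// powRr1.
Qed.

Lemma LpB p f g : 1 <= p -> Lp w p f -> Lp w p g -> Lp w p (fun x => f x - g x).
Proof.
move=> p1 /LpE[mf lf] /LpE[mg lg]; apply/LpE; split; first exact: measurable_funB.
by apply: le_lt_trans (Lp_normB p1 mf mg) _; exact: lte_add_pinfty.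
Qed.

Lemma Lp_le p f g : 0 < p -> measurable_fun [set: R] f -> Lp w p g ->
  (forall x, `|f x| <= `|g x|) -> Lp w p f.
Proof.
move=> p0 mf /LpE[mg lg] fg; apply/LpE; split => //.
exact: le_lt_trans (Lp_norm_le _ _ _ fg) lg.
Qed.

End weighted_norm.

(** * The Muckenhoupt condition on an interval *)

Section averages.
Context {R : realType} (w : weight R).
Implicit Types (f g : R -> R) (p : R) (J : set R).

Lemma weight_measure_gt0 J : measurable J -> (0 < leb J)%E ->
  (0 < weight_measure w J)%E.
Proof.
move=> mJ J0; rewrite lt0e measure_ge0 andbT.
apply/negP => /eqP WJ0.
have mw : measurable_fun J (fun x => (w x)%:E).
  by apply/measurable_EFinP/measurable_funTS; exact: measurable_weight.
have /(ae_eq_integral_abs leb mJ mw) w0 : (\int[leb]_(x in J) `|(w x)%:E| = 0)%E.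
  exact: WJ0.
have : leb.-negligible J.
  have : {ae leb, forall x, ~ J x}.
    apply: filterS2 (weight_ae_gt0 w) w0 => x wx + Jx => /(_ Jx) [] wx0.
    by rewrite wx0 ltxx in wx.
  by rewrite /almost_everywhere/=; apply: negligibleS => x Jx /(_ Jx).
move/negligibleP => /(_ mJ) /= J00.
by rewrite J00 ltxx in J0.
Qed.

(** Hoelder's inequality for [f w^(1/p)] and [w^(-1/p)] on [J]: the exponent
    conjugate to [p] turns the second factor into the dual weight. *)
Lemma hoelder_weight p J f : 1 < p -> measurable J ->
  measurable_fun [set: R] f ->
  (\int[leb]_(x in J) `|f x|%:E <= Lp_norm w p f *
   (\int[leb]_(x in J) (dual_weight p w x)%:E) `^ (conjugate_exponent p)^-1)%E.
Proof.
move=> p1 mJ mf; set q := conjugate_exponent p.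
have p0 : 0 < p by lra.
have pN0 : p != 0 by rewrite gt_eqF.
have p1N0 : p - 1 != 0 by apply/eqP; lra.
have q0 : 0 < q by rewrite /q /conjugate_exponent divr_gt0// subr_gt0.
have qN0 : q != 0 by rewrite gt_eqF.
have mw := measurable_weight w.
have mwp (r : R) : measurable_fun [set: R] (fun x => `|w x| `^ r).
  apply: (@measurableT_comp _ _ _ _ _ _ (@powR R ^~ r)) => //.
  exact: measurableT_comp.
have mJ1 : measurable_fun [set: R] (\1_J : R -> R) by exact: measurable_indic.
pose F x := `|f x| * `|w x| `^ p^-1 * \1_J x.
pose G x := `|w x| `^ (- p^-1) * \1_J x.
have mF : measurable_fun [set: R] F.
  by apply: measurable_funM => //; apply: measurable_funM => //;
    exact: measurableT_comp.
have mG : measurable_fun [set: R] G by exact: measurable_funM.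
have := hoelder leb mF mG p0 q0.
have -> : p^-1 + q^-1 = 1.
  by rewrite /q /conjugate_exponent invf_div; field.
move=> /(_ erefl).
have idem (x : R) : \1_J x * \1_J x = \1_J x :> R.
  by rewrite !indicE; case: (x \in J); rewrite ?mulr1 ?mulr0.
have -> : ('N[leb]_1[EFin \o (F \* G)%R] = \int[leb]_(x in J) `|f x|%:E)%E.
  rewrite Lnorm1 [RHS]integral_mkcond; apply: ge0_ae_eq_integral => //.
  - by apply/measurable_EFinP/measurableT_comp => //; exact: measurable_funM.
  - apply/(measurable_restrictT _ mJ).
    by apply/measurable_EFinP/measurable_funTS/measurableT_comp.
  - by move=> x _; rewrite erestrict_ge0// => y _; rewrite lee_fin.
  apply: filterS (weight_ae_gt0 w) => x wx _.
  rewrite /= patchE /F /G.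
  have -> : `|f x| * `|w x| `^ p^-1 * \1_J x * (`|w x| `^ (- p^-1) * \1_J x) =
     `|f x| * (`|w x| `^ p^-1 * `|w x| `^ (- p^-1)) * (\1_J x * \1_J x).
    by ring.
  rewrite idem -powRD; last by rewrite subrr eqxx/= normr_eq0 gt_eqF.
  rewrite subrr powRr0 mulr1 indicE; case: ifPn => _; last by rewrite mulr0 normr0.
  by rewrite mulr1 normr_id.
move=> /le_trans; apply; apply: lee_pmul.
- exact: Lnorm_ge0.
- exact: Lnorm_ge0.
- rewrite Lp_norm_root// unlock; apply: gt0_ler_poweR.
  + by rewrite invr_ge0 ltW.
  + by rewrite in_itv/= leey andbT; apply: integral_ge0 => x _; rewrite lee_fin powR_ge0.
  + by rewrite in_itv/= leey andbT; apply: integral_ge0 => x _; rewrite lee_fin powR_ge0.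
  rewrite integral_weight_measure//; last exact: measurable_normr_powR.
  apply: ge0_le_integral => //.
  + by move=> x _; rewrite poweR_ge0.
  + exact: (measurable_normr_powR p mF).
  + apply: emeasurable_funM; first exact: measurable_normr_powR.
    by apply/measurable_EFinP; exact: measurableT_comp.
  move=> x _; rewrite -EFinM lee_fin /F !normrM !powRM ?normr_ge0//.
  rewrite normr_id (ger0_norm (powR_ge0 _ _)) -powRrM mulVf// powRr1//.
  rewrite -[leRHS]mulr1 ler_wpM2l ?mulr_ge0 ?powR_ge0//.
  by rewrite indicE; case: (x \in J); rewrite ?normr1 ?powR1// normr0 powR0.
- rewrite unlock; apply: gt0_ler_poweR.
  + by rewrite invr_ge0 ltW.
  + by rewrite in_itv/= leey andbT; apply: integral_ge0 => x _; rewrite lee_fin powR_ge0.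
  + by rewrite in_itv/= leey andbT; apply: integral_ge0 => x _; rewrite lee_fin powR_ge0.
  have mdw : measurable_fun [set: R] (fun x => (dual_weight p w x)%:E).
    apply/measurable_EFinP.
    by apply: (@measurableT_comp _ _ _ _ _ _ (@powR R ^~ _)).
  rewrite [leRHS]integral_mkcond; apply: ae_ge0_le_integral => //.
  + by move=> x _; rewrite poweR_ge0.
  + exact: (measurable_normr_powR q mG).
  + by move=> x _; rewrite erestrict_ge0// => y _; rewrite lee_fin powR_ge0.
  + by apply/(measurable_restrictT _ mJ)/measurable_funTS.
  apply: filterS (weight_ae_gt0 w) => x wx _.
  rewrite /= patchE /G normrM (ger0_norm (powR_ge0 _ _)) powRM//.
  rewrite -powRrM indicE; case: ifPn => _; last first.
    by rewrite normr0 powR0// mulr0.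
  rewrite normr1 powR1 mulr1 lee_fin gtr0_norm// /dual_weight -/q.
  rewrite (_ : - p^-1 * q = 1 - q)// /q /conjugate_exponent.
  by field; rewrite pN0 p1N0.
Qed.

Lemma Lp_norm_indic p J : 0 < p -> measurable J ->
  Lp_norm w p \1_J = (weight_measure w J `^ p^-1)%E.
Proof.
move=> p0 mJ; rewrite Lp_norm_root//; congr (_ `^ _)%E.
rewrite (eq_integral (fun x => (\1_J x)%:E)).
  by rewrite integral_indic// setIT.
move=> x _; rewrite indicE; case: (x \in J); first by rewrite normr1 powR1.
by rewrite normr0 powR0// gt_eqF.
Qed.

(** What the [A_p] condition says on a single interval: averaging over [J] is
    bounded on [L^p(w)] with a constant that depends on [Q] only, since by
    Hoelder's inequality the norm is at most
    [w(J)^(1/p) w'(J)^(1/p') / |J|] times that of [f].  Positivity of [w(J)]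
    makes [w'(J)] finite, hence [f] integrable on [J]. *)
Lemma Ap_average p J f (Q : R) : 1 < p -> measurable J ->
  (0 < leb J)%E -> (leb J < +oo)%E -> (weight_measure w J < +oo)%E ->
  ((\int[leb]_(x in J) (w x)%:E) / leb J *
     ((\int[leb]_(x in J) (dual_weight p w x)%:E) / leb J) `^ (p - 1) <= Q%:E)%E ->
  Lp w p f ->
  leb.-integrable J (EFin \o f) /\
  (Lp_norm w p (fun x => (average (fun y => `|f y|) J * \1_J x)%R)
   <= (Q `^ p^-1)%:E * Lp_norm w p f)%E.
Proof.
move=> p1 mJ J0 Joo WJoo + /LpE[mf lf].
have p0 : 0 < p by lra.
have WJ0 := weight_measure_gt0 mJ J0.
have fle := hoelder_weight p1 mJ mf.
have V0 : (0 <= \int[leb]_(x in J) (dual_weight p w x)%:E)%E.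
  by apply: integral_ge0 => x _; rewrite lee_fin powR_ge0.
have N0 := Lp_norm_ge0 w p f.
have lenE : leb J = (len J)%:E by rewrite fineK// ge0_fin_numE// ltW.
have -> : (\int[leb]_(x in J) (w x)%:E = weight_measure w J)%E.
  apply: ae_eq_integral => //.
  - by apply/measurable_EFinP/measurable_funTS; exact: measurable_weight.
  - apply/measurable_EFinP/measurable_funTS/measurableT_comp => //.
    exact: measurable_weight.
  - by apply: filterS (weight_ae_gt0 w) => x wx _; rewrite gtr0_norm.
rewrite lenE in J0 *; rewrite lte_fin in J0.
have L0 : len J != 0 by rewrite gt_eqF.
rewrite inver (negbTE L0).
move: WJ0 WJoo.
case WE : (weight_measure w J) => [W| |]// + _.
rewrite lte_fin => W0.
case NE : (Lp_norm w p f) N0 lf fle => [N| |]//; rewrite lee_fin => N0 _ + Ap.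
case VE : (\int[leb]_(x in J) (dual_weight p w x)%:E)%E V0 Ap => [V| |]//; last first.
  move=> _; rewrite gt0_mulye ?lte_fin ?invr_gt0// poweRyr; last by apply/eqP; lra.
  by rewrite -EFinM gt0_muley ?leye_eq// lte_fin divr_gt0.
rewrite lee_fin -!EFinM lee_fin => V0 Ap.
move=> fle.
have mfJ : measurable_fun J (EFin \o f) by apply/measurable_EFinP/measurable_funTS.
have fint : leb.-integrable J (EFin \o f).
  by apply/integrableP; split => //; exact: le_lt_trans fle (ltry _).
split => //.
have avg0 : 0 <= average (fun y => `|f y|) J.
  by rewrite divr_ge0// ?Rintegral_ge0// ltW.
have mJ1 : measurable_fun [set: R] (\1_J : R -> R) by exact: measurable_indic.
rewrite (Lp_normZ w _ p0 mJ1) Lp_norm_indic// [weight_measure w J]WE poweR_EFin -!EFinM lee_fin ger0_norm//.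
have avgle : average (fun y => `|f y|) J <= N * V `^ (conjugate_exponent p)^-1 / len J.
  rewrite /average ler_wpM2r ?invr_ge0 ?(ltW J0)// -lee_fin /Rintegral fineK//.
  by rewrite ge0_fin_numE; [exact: le_lt_trans fle (ltry _)|exact: integral_ge0].
apply: le_trans (ler_wpM2r _ avgle) _; first exact: powR_ge0.
have -> : N * V `^ (conjugate_exponent p)^-1 / len J * W `^ p^-1 =
   (W `^ p^-1 * V `^ (conjugate_exponent p)^-1 / len J) * N by ring.
apply: ler_wpM2r => //.
have [A WA] : exists A, W = A * len J by exists (W / len J); rewrite divfK.
have [B VB] : exists B, V = B * len J by exists (V / len J); rewrite divfK.
have A0 : 0 <= A by have := ltW W0; rewrite WA pmulr_lge0.
have B0 : 0 <= B by have := V0; rewrite VB pmulr_lge0.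
move: Ap; rewrite WA VB !mulfK// => Ap.
rewrite !powRM ?(ltW J0)//.
have cE : (conjugate_exponent p)^-1 = (p - 1) * p^-1 by rewrite /conjugate_exponent invf_div.
have -> : A `^ p^-1 * len J `^ p^-1 *
   (B `^ (conjugate_exponent p)^-1 * len J `^ (conjugate_exponent p)^-1) / len J =
   A `^ p^-1 * B `^ (conjugate_exponent p)^-1.
  rewrite [X in X / _](_ : _ = A `^ p^-1 * B `^ (conjugate_exponent p)^-1 *
    (len J `^ p^-1 * len J `^ (conjugate_exponent p)^-1)); last by ring.
  rewrite -powRD; last by rewrite L0 implybT.
  have -> : p^-1 + (conjugate_exponent p)^-1 = 1 by rewrite cE; field; apply/eqP; lra.
  by rewrite powRr1 ?(ltW J0)// mulfK.
rewrite cE powRrM -powRM ?powR_ge0//.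
apply: ge0_ler_powR => //.
- by rewrite invr_ge0 ltW.
- by rewrite nnegrE mulr_ge0 ?powR_ge0.
- by rewrite nnegrE (le_trans _ Ap)// mulr_ge0 ?powR_ge0.
Qed.

End averages.

(** * Geometry of a dyadic grid *)

Section dyadic_geometry.
Context {R : realType}.
Implicit Types (I J : set R) (f g : R -> R).

(** As grid intervals may contain their endpoints or not, they are handled by two
    inclusions, which determine them up to endpoints. *)
Lemma interval_bounds I (l : R) : is_interval I -> leb I = l%:E -> 0 < l ->
  [/\ sup I = inf I + l, (forall x, inf I < x < sup I -> I x) &
      forall x, I x -> inf I <= x <= sup I].
Proof.
move=> /is_intervalP II Il l0.
have I0 : I !=set0.
  apply/set0P/eqP => I0; move: Il; rewrite I0 measure0 => -[] l00.
  by rewrite -l00 ltxx in l0.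
move: Il; rewrite {1}II lebesgue_measure_itv /Rhull /=.
have [lb|lb] := asboolP (has_lbound I); have [ub|ub] := asboolP (has_ubound I) => /=;
  rewrite ?bnd_simp ?ltry ?ltNyr //=.
case: ifPn => [_|_ [l00]]; last by rewrite -l00 ltxx in l0.
rewrite -EFinB => -[lE].
split; first by rewrite -lE addrC subrK.
- move=> x /andP[ax xb]; rewrite II /Rhull /= (asboolT lb) (asboolT ub) in_itv/=.
  by apply/andP; split; case: asboolP => _ /=; rewrite ?(ltW ax) ?ax ?(ltW xb) ?xb.
- by move=> x Ix; rewrite ge_inf//= ub_le_sup.
Qed.

Lemma ae_neq (c : R) : {ae leb, forall x, x != c}.
Proof.
rewrite /almost_everywhere/=; exists [set c]; split => //.
  exact: lebesgue_measure_set1.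
by move=> x /= /negP; rewrite negbK => /eqP.
Qed.

Section grid.
Variables (D : set (set R)) (hD : dyadic_grid D).

Lemma grid_lenE I : D I -> exists k : int, len I = 2 ^ k.
Proof.
by case: hD => h _ _ /h[k [_ Ik]]; exists k; rewrite /len Ik.
Qed.

Lemma grid_len_gt0 I : D I -> 0 < len I.
Proof. by move=> /grid_lenE[k ->]; exact: exprz_gt0. Qed.

Lemma grid_leb I : D I -> leb I = (len I)%:E.
Proof. by case: hD => h _ _ /h[k [_ Ik]]; rewrite /len Ik. Qed.

Lemma grid_is_interval I : D I -> is_interval I.
Proof. by case: hD => h _ _ /h[k []]. Qed.

Lemma grid_measurable I : D I -> measurable I.
Proof. by move=> DI; exact: is_interval_measurable (grid_is_interval DI). Qed.

Lemma grid_bounds I : D I ->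
  [/\ sup I = inf I + len I, (forall x, inf I < x < sup I -> I x) &
      forall x, I x -> inf I <= x <= sup I].
Proof.
move=> DI; apply: interval_bounds; first exact: grid_is_interval.
  exact: grid_leb.
exact: grid_len_gt0.
Qed.

Lemma grid_neq0 I : D I -> exists x, I x.
Proof.
move=> DI; have [sE Iin _] := grid_bounds DI; have l0 := grid_len_gt0 DI.
by exists (inf I + len I / 2); apply: Iin; rewrite sE; lra.
Qed.

Lemma grid_cell (k : int) (x : R) : exists I, [/\ D I, len I = 2 ^ k & I x].
Proof.
case: hD => _ /(_ k)[cov _ _] _.
have : [set: R] x by [].
by rewrite -cov => -[I [DI [_ Ik]] Ix]; exists I; split => //; rewrite /len Ik.
Qed.

Lemma grid_le_len I J : D I -> D J -> I `<=` J -> len I <= len J.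
Proof.
move=> DI DJ IJ; rewrite -lee_fin -!grid_leb//.
by apply: le_measure; rewrite ?inE//; exact: grid_measurable.
Qed.

(** Intervals of the same generation belong to one partition of the line. *)
Lemma grid_eq I J x : D I -> D J -> len I = len J -> I x -> J x -> I = J.
Proof.
move=> DI DJ IJ Ix Jx; case: hD => dy part _.
have [k [itI Ik]] := dy _ DI.
have [_ triv _] := part k.
apply: triv; last by exists x.
- by [].
- split => //; split; first exact: grid_is_interval.
  by rewrite grid_leb// -IJ -grid_leb.
Qed.

Lemma grid_nested I J x : D I -> D J -> len I <= len J -> I x -> J x -> I `<=` J.
Proof.
move=> DI DJ IJ Ix Jx; case: hD => _ _ /(_ I J DI DJ)[IJI|IJJ|IJ0].
- by rewrite -IJI; exact: subIsetr.
- have JI : J `<=` I by rewrite -IJJ; exact: subIsetl.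
  by rewrite (@grid_eq I J x)//; apply/eqP; rewrite eq_le IJ grid_le_len.
- by have : (I `&` J) x by []; rewrite IJ0.
Qed.

Lemma grid_trichotomy I J : D I -> D J ->
  [\/ I `<=` J, J `<=` I | I `&` J = set0].
Proof.
move=> DI DJ; case: hD => _ _ /(_ I J DI DJ)[<-|<-|IJ0].
- by constructor 1; exact: subIsetr.
- by constructor 2; exact: subIsetl.
- by constructor 3.
Qed.

Lemma grid_parent I : D I -> exists J, [/\ D J, I `<=` J & len J = 2 * len I].
Proof.
move=> DI; have [k Ik] := grid_lenE DI; have [x Ix] := grid_neq0 DI.
have [J [DJ Jk Jx]] := grid_cell (k + 1) x.
have JI : len J = 2 * len I by rewrite Jk Ik expfzDr ?pnatr_eq0// mulrC expr1z.
exists J; split => //; apply: (@grid_nested I J x) => //.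
by rewrite JI; have := grid_len_gt0 DI; lra.
Qed.

Lemma grid_child J x : D J -> J x -> exists I, [/\ D I, I `<=` J, len J = 2 * len I & I x].
Proof.
move=> DJ Jx; have [k Jk] := grid_lenE DJ.
have [I [DI Ik Ix]] := grid_cell (k - 1) x.
have JI : len J = 2 * len I by rewrite Jk Ik expfzDr ?pnatr_eq0// exprN1; field.
exists I; split => //; apply: (@grid_nested I J x) => //.
by rewrite JI; have := grid_len_gt0 DI; lra.
Qed.

(** The default value [set0] is only taken outside the grid. *)
Definition parent I : set R :=
  xget set0 [set J | [/\ D J, I `<=` J & len J = 2 * len I]].

Lemma parentP I : D I ->
  [/\ D (parent I), I `<=` parent I & len (parent I) = 2 * len I].
Proof.
move=> /grid_parent[J PJ].
exact: (@xgetI _ set0 [set J | [/\ D J, I `<=` J & len J = 2 * len I]] J PJ).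
Qed.

Lemma ancestorP I n : D I ->
  [/\ D (iter n parent I), I `<=` iter n parent I &
      len (iter n parent I) = 2 ^+ n * len I].
Proof.
move=> DI; elim: n => [|n [Dn In ln]]; first by split => //=; rewrite expr0 mul1r.
have [Dp np lp] := parentP Dn.
split; [exact: Dp|exact: subset_trans In np|].
by rewrite iterS lp ln exprS mulrA.
Qed.

Lemma sub_ancestor I J : D I -> D J -> I `<=` J -> exists n, J = iter n parent I.
Proof.
move=> DI DJ IJ; have [i Ii] := grid_lenE DI; have [j Jj] := grid_lenE DJ.
have [x Ix] := grid_neq0 DI.
have ij : (i <= j)%R.
  by rewrite -(@ler_eXz2l _ (2 : R))// ?ltr1n// -Ii -Jj grid_le_len.
have [n jE] : exists n : nat, j = i + n%:Z.
  by exists `|j - i|%N; rewrite gez0_abs ?subr_ge0// addrCA subrr addr0.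
exists n; have [Dn In ln] := ancestorP n DI.
apply: (@grid_eq _ _ x) => //; [|exact: IJ|exact: In].
by rewrite ln Jj Ii jE expfzDr ?pnatr_eq0// mulrC.
Qed.

End grid.
End dyadic_geometry.

(** * Haar functions and ancestors *)

Section grid_haar.
Context {R : realType}.
Implicit Types (I J : set R) (f g : R -> R).
Variables (D : set (set R)) (hD : dyadic_grid D).

Lemma grid_mem I x : D I -> x != inf I -> x != sup I ->
  (x \in I) = (inf I < x < sup I).
Proof.
move=> DI xi xs; have [_ sub1 sub2] := grid_bounds hD DI.
apply/idP/idP => [/set_mem/sub2 /andP[ix sx]|/sub1 Ix]; last exact: mem_set.
by rewrite !lt_neqAle ix sx xs eq_sym xi.
Qed.

Lemma grid_inf_sup I J : D I -> D J -> I `<=` J -> inf J <= inf I /\ sup I <= sup J.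
Proof.
move=> DI DJ IJ; have [x Ix] := grid_neq0 hD DI.
have [_ _ bJ] := grid_bounds hD DJ.
split.
- by apply: lb_le_inf; [exists x|move=> y /IJ/bJ/andP[]].
- by apply: sup_le_ub; [exists x|move=> y /IJ/bJ/andP[]].
Qed.

(** Up to its sign [e], a Haar function is determined by either child of its
    interval, because the two children are almost everywhere the two halves.
    This form avoids distinguishing left from right in all later
    computations. *)
Lemma haar_child I J : D I -> D J -> I `<=` J -> len J = 2 * len I ->
  exists2 e : R, e ^+ 2 = 1 & {ae leb, forall x,
    haar J x = e * (Num.sqrt (len J))^-1 * (2 * \1_I x - \1_J x)}.
Proof.
move=> DI DJ IJ JI; have l0 := grid_len_gt0 hD DI.
have [y Jy nIy] : exists2 y, J y & ~ I y.
  apply: contrapT => /forall2NP JI'.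
  have : len J <= len I.
    by apply: (grid_le_len hD) => // y Jy; have [//|/contrapT] := JI' y.
  by rewrite JI; lra.
have [I' [DI' I'J JI' I'y]] := grid_child hD DJ Jy.
have ll : len I' = len I by lra.
have [sI inI _] := grid_bounds hD DI.
have [sI' inI' _] := grid_bounds hD DI'.
have [sJ _ _] := grid_bounds hD DJ.
have [aI bI] := grid_inf_sup DI DJ IJ.
have [aI' bI'] := grid_inf_sup DI' DJ I'J.
have dis x : I x -> I' x -> False.
  by move=> Ix I'x; apply: nIy; rewrite (grid_eq hD DI DI' _ Ix I'x).
have : inf I + len I <= inf I' \/ inf I' + len I <= inf I.
  have [h|h] := lerP (inf I + len I) (inf I'); first by left.
  have [h'|h'] := lerP (inf I' + len I) (inf I); first by right.
  exfalso; have [cmp|cmp] := lerP (inf I) (inf I').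
    by apply: (dis ((inf I' + sup I) / 2)); [apply: inI|apply: inI'];
      rewrite ?sI ?sI' ?ll; lra.
  by apply: (dis ((inf I + sup I') / 2)); [apply: inI|apply: inI'];
    rewrite ?sI ?sI' ?ll; lra.
have side : inf I + len I <= inf I' \/ inf I' + len I <= inf I ->
    inf I = inf J \/ inf I = inf J + len I.
  by rewrite sJ sI sI' ll JI in bI bI' * => -[h|h]; [left|right]; lra.
move=> /side {}side.
(* I and its sibling I' are disjoint intervals of half the length of J, so each
   starts at the left end or at the midpoint of J. *)
pose e : R := if inf I == inf J then -1 else 1.
exists e; first by rewrite /e; case: ifP; rewrite ?sqrrN expr1n.
apply: filterS3 (ae_neq (inf J)) (ae_neq (inf J + len I)) (ae_neq (sup J)).
move=> x xa xm xb.
have mE : midpoint J = inf J + len I by rewrite /midpoint sJ JI; lra.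
have mem_ge : (x \in [set z | midpoint J <= z]) = (inf J + len I <= x).
  by rewrite -mE; apply/idP/idP => [/set_mem|h]; last exact: mem_set.
have mem_lt : (x \in [set z | z < midpoint J]) = (x < inf J + len I).
  by rewrite -mE; apply/idP/idP => [/set_mem|h]; last exact: mem_set.
have IE : (x \in I) = (inf I < x < inf I + len I).
  rewrite grid_mem ?sI//; case: side => ->//.
  by rewrite (_ : _ + _ + _ = sup J)// sJ JI; lra.
rewrite /haar /right_half /left_half !indicE !in_setI mem_ge mem_lt IE.
rewrite (grid_mem DJ xa xb) sJ JI.
rewrite [e * _]mulrC -mulrA; congr (_ * _).
rewrite leNgt; case: side => IJE.
  have -> : (inf I < x < inf I + len I) =
      (inf J < x < inf J + 2 * len I) && (x < inf J + len I).
    rewrite IJE; apply/idP/idP => [/andP[h1 h2]|/andP[/andP[h1 _] ->]].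
      by rewrite h1 h2/= andbT; lra.
    by rewrite h1.
  rewrite /e IJE eqxx.
  by case: (x < inf J + len I); case: (inf J < x < inf J + 2 * len I) => /=; ring.
have -> : (inf I < x < inf I + len I) =
    (inf J < x < inf J + 2 * len I) && ~~ (x < inf J + len I).
  rewrite -leNgt IJE; apply/idP/idP => [/andP[h1 h2]|/andP[/andP[_ h1] h2]].
    by rewrite (ltW h1) andbT; apply/andP; split; lra.
  by rewrite lt_neqAle eq_sym xm h2/=; lra.
rewrite /e (_ : _ == _ = false); last by rewrite IJE; apply/eqP; lra.
by case: (x < inf J + len I); case: (inf J < x < inf J + 2 * len I) => /=; ring.
Qed.

Lemma integral_mul_indic f I : measurable I ->
  \int[leb]_x (f x * \1_I x) = \int[leb]_(x in I) f x.
Proof.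
move=> mI; rewrite [RHS]Rintegral_mkcond; apply: eq_Rintegral => x _.
by rewrite patchE indicE; case: ifPn; rewrite ?mulr1 ?mulr0.
Qed.

Lemma integrable_mul_indic f I : measurable I -> leb.-integrable I (EFin \o f) ->
  leb.-integrable setT (fun x => (f x * \1_I x)%:E).
Proof.
move=> mI; move/(@integrable_mkcond _ _ _ leb _ _ mI); apply: eq_integrable => // x _.
by rewrite patchE indicE; case: ifPn; rewrite ?mulr1 ?mulr0.
Qed.

Lemma measurable_haar J : D J -> measurable_fun [set: R] (haar J).
Proof.
move=> DJ; apply: measurable_funM => //; apply: measurable_funB;
  apply: measurable_indic; apply: measurableI; try exact: (grid_measurable hD).
- by rewrite -set_itvcy; exact: measurable_itv.
- by rewrite -set_itvNyo; exact: measurable_itv.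
Qed.

Lemma pairing_haar f I J (e : R) : D I -> D J -> I `<=` J ->
  measurable_fun [set: R] f -> leb.-integrable J (EFin \o f) ->
  {ae leb, forall x,
    haar J x = e * (Num.sqrt (len J))^-1 * (2 * \1_I x - \1_J x)} ->
  pairing f (haar J) = e * (Num.sqrt (len J))^-1 *
    (2 * \int[leb]_(x in I) f x - \int[leb]_(x in J) f x).
Proof.
move=> DI DJ IJ mf fJ hE.
have mI := grid_measurable hD DI; have mJ := grid_measurable hD DJ.
have fI : leb.-integrable I (EFin \o f) by exact: integrableS fJ.
set c := e * _.
have m1 (K : set R) : measurable K -> measurable_fun [set: R] (\1_K : R -> R).
  by move=> mK; exact: measurable_indic.
transitivity (\int[leb]_x (c * (2 * (f x * \1_I x) - f x * \1_J x))).
  rewrite /pairing /Rintegral; congr fine; apply: ae_eq_integral => //.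
  - apply/measurable_EFinP; apply: measurable_funM => //.
    exact: measurable_haar.
  - apply/measurable_EFinP; apply: measurable_funM => //.
    apply: measurable_funB; last by apply: measurable_funM => //; exact: m1.
    by apply: measurable_funM => //; apply: measurable_funM => //; exact: m1.
  apply: filterS hE => x -> _; rewrite -/c; congr EFin; ring.
have iI := integrable_mul_indic mI fI; have iJ := integrable_mul_indic mJ fJ.
have iI2 : leb.-integrable setT (EFin \o (fun x => 2 * (f x * \1_I x))).
  exact: integrableZl iI.
rewrite RintegralZl//; last exact: (integrableB _ iI2 iJ).
by rewrite RintegralB// RintegralZl// !integral_mul_indic.
Qed.

Lemma pairing_haar_out f J : D J -> {ae leb, forall x, J x -> f x = 0} ->
  measurable_fun [set: R] f -> pairing f (haar J) = 0.
Proof.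
move=> DJ f0 mf; rewrite /pairing /Rintegral.
rewrite (ae_eq_integral (cst 0)) ?integral0//.
- by apply/measurable_EFinP; apply: measurable_funM => //; exact: measurable_haar.
- apply: filterS f0 => x f0 _ /=.
  have [/f0 ->|nJ] := pselect (J x); first by rewrite mul0r.
  rewrite /haar /right_half /left_half !indicE !in_setI memNset//=.
  by rewrite subrr !mulr0.
Qed.

Lemma integrable_cst_grid J (c : R) : D J ->
  leb.-integrable J (EFin \o cst c).
Proof.
move=> DJ; have mJ := grid_measurable hD DJ.
apply/integrableP; split; first by apply/measurable_EFinP.
by rewrite (eq_integral (cst `|c|%:E))// integral_cst//= (grid_leb hD)// -EFinM ltry.
Qed.

Lemma Rintegral_cst_grid J (c : R) : D J ->
  \int[leb]_(x in J) c = c * len J.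
Proof.
move=> DJ; have mJ := grid_measurable hD DJ.
by rewrite (Rintegral_cst leb mJ).
Qed.

Lemma Rintegral_indic_grid I J : D I -> D J -> I `<=` J ->
  \int[leb]_(x in J) \1_I x = len I.
Proof.
move=> DI DJ IJ; have mI := grid_measurable hD DI; have mJ := grid_measurable hD DJ.
by rewrite /Rintegral integral_indic// setIidl.
Qed.

Lemma integrable_indic_grid I J : D I -> D J ->
  leb.-integrable J (EFin \o (\1_I : R -> R)).
Proof.
move=> DI DJ; have mI := grid_measurable hD DI; have mJ := grid_measurable hD DJ.
apply/integrableP; split.
  by apply/measurable_EFinP; exact: measurable_indic.
under eq_integral do rewrite /= ger0_norm//.
rewrite integral_indic//= (le_lt_trans (measureIr _ _ _))//=.
by rewrite (grid_leb hD)// ltry.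
Qed.

(** The strict ancestors of [I] of length at most [M] form an initial segment of
    the chain of iterated parents, and the last of them has length comparable
    to [M]. *)
Lemma ancestors_below I (M : R) : D I -> len I <= M -> exists n,
  M < 2 * len (iter n (parent D) I) /\
  [set J | [/\ D J, I `<` J & len J <= M]] =
  [set iter k.+1 (parent D) I | k in `I_n].
Proof.
move=> DI IM; have l0 := grid_len_gt0 hD DI.
have exn : exists n, M < 2 ^+ n.+1 * len I.
  exists (Num.trunc (M / len I)); rewrite -ltr_pdivrMr//.
  apply: lt_trans (truncnS_gt _) _.
  rewrite -natrX ltr_nat; exact: ltn_expl.
pose P n := M < 2 ^+ n.+1 * len I.
have [n Pn minn] := @ex_minnP P exn.
have nM : 2 ^+ n * len I <= M.
  case: n Pn minn => [_ _|n _ minn]; first by rewrite expr0 mul1r.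
  rewrite leNgt; apply/negP => /(minn n); rewrite ltnn//.
exists n; split.
  by have [_ _ ->] := ancestorP hD n DI; rewrite mulrA -exprS.
apply/seteqP; split => [J [DJ [IJ JI] JM]|_ [k /= kn <-]].
  have [m JE] := sub_ancestor hD DI DJ IJ.
  case: m JE => [JE|m JE]; first by exfalso; apply: JI; rewrite JE.
  exists m => //=.
  have [_ _ lm] := ancestorP hD m.+1 DI.
  rewrite JE lm in JM; have := le_lt_trans JM Pn.
  by rewrite ltr_pM2r// ltr_eXn2l ?ltr1n.
have [Dk Ik lk] := ancestorP hD k.+1 DI.
split; first exact: Dk.
- split; first exact: Ik.
  move=> kI; have := grid_le_len hD Dk DI kI; rewrite lk exprS.
  have : 1 <= 2 ^+ k :> R by rewrite exprn_ege1// ler1n.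
  by nra.
- rewrite lk; apply: le_trans nM; rewrite ler_wpM2r ?(ltW l0)//.
  by rewrite ler_eXn2l ?ltr1n.
Qed.

(** An interval is determined by its generation and a rational point in it. *)
Lemma grid_countable : countable D.
Proof.
have /choice[c cP] : forall kq : int * rat, exists I : set R,
  [/\ D I, len I = 2 ^ kq.1 & I (ratr kq.2)].
  by move=> kq; exact: (grid_cell hD).
apply: (@sub_countable _ _ _ (c @` setT)).
  apply: subset_card_le => J DJ.
  have [k Jk] := grid_lenE hD DJ.
  have [sJ inJ _] := grid_bounds hD DJ.
  have : inf J < sup J by rewrite sJ ltrDl (grid_len_gt0 hD DJ).
  move=> /rat_in_itvoo[q]; rewrite in_itv/= => /inJ Jq.
  have [Dc lc cq] := cP (k, q).
  by exists (k, q) => //; apply: (grid_eq hD Dc DJ _ cq Jq); rewrite lc Jk.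
exact: sub_countable (card_image_le _ _) (countableP _).
Qed.

Lemma weight_measure_grid_lty (w : weight R) J : D J -> (weight_measure w J < +oo)%E.
Proof.
move=> DJ; have [mw _ loc] := weight_locally_integrable w.
have [_ _ Jab] := grid_bounds hD DJ.
have cptJ : compact `[inf J, sup J]%classic by exact: segment_compact.
apply: le_lt_trans (loc _ (@subsetT _ _) cptJ).
apply: ge0_subset_integral => //.
- exact: (grid_measurable hD).
- by apply/measurable_EFinP/measurable_funTS/measurableT_comp.
Qed.

Lemma grid_Ap (w : weight R) (p : R) : 1 < p -> Ap_weight D p w ->
  exists2 K : R, 0 <= K & forall J f, D J -> Lp w p f ->
  leb.-integrable J (EFin \o f) /\
  (Lp_norm w p (fun x => (average (fun y => `|f y|) J * \1_J x)%R)
   <= K%:E * Lp_norm w p f)%E.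
Proof.
rewrite /Ap_weight => p1; set A := [set _ | _ in D] => Aoo.
have [Q HQ] : exists Q : R, (ereal_sup A <= Q%:E)%E.
  by case: ereal_sup Aoo => [r _| //|_]; [exists r|exists 0; rewrite leNye].
exists (Q `^ p^-1); first exact: powR_ge0.
move=> J f DJ Lf; apply: Ap_average => //.
- exact: (grid_measurable hD).
- by rewrite (grid_leb hD)// lte_fin (grid_len_gt0 hD).
- by rewrite (grid_leb hD)// ltry.
- exact: weight_measure_grid_lty.
- by apply: le_trans HQ; apply: ereal_sup_ubound; exists J.
Qed.

End grid_haar.

(** * The product rule along the ancestors of an interval *)

Section telescoping.
Context {R : realType}.
Implicit Types (I J : set R) (f g : R -> R).
Variables (D : set (set R)) (hD : dyadic_grid D).

(** The contribution of [I] to the multiplier of the martingale transform. *)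
Definition inner_fraction I J : R := if `[< I `<` J >] then len I / len J else 0.

(** The [J]-th terms of the three series with [b] and [tau] those of the
    one-element collection [I]. *)
Definition product_term f I J (x : R) : R :=
  pairing \1_I (haar J) * average f J * haar J x +
  pairing \1_I (haar J) * pairing f (haar J) * (\1_J x / len J) +
  inner_fraction I J * pairing f (haar J) * haar J x.

(** Unless [J] strictly contains [I], the indicator of [I] is constant on [J]. *)
Lemma pairing_indic_out I J : D I -> D J -> ~ I `<` J ->
  pairing \1_I (haar J) = 0.
Proof.
move=> DI DJ nIJ.
have mI : measurable_fun [set: R] (\1_I : R -> R).
  by apply: measurable_indic; exact: grid_measurable DI.
have IJ0 : I `&` J = set0 -> pairing \1_I (haar J) = 0.
  move=> IJ; apply: (pairing_haar_out hD) => //; apply: aeW => x Jx.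
  rewrite indicE memNset// => Ix.
  by have : (I `&` J) x by []; rewrite IJ.
have JI0 : J `<=` I -> pairing \1_I (haar J) = 0.
  move=> JI; have [x Jx] := grid_neq0 hD DJ.
  have [J' [DJ' J'J lJ _]] := grid_child hD DJ Jx.
  have [e _ hE] := haar_child hD DJ' DJ J'J lJ.
  rewrite (pairing_haar hD DJ' DJ J'J mI (integrable_indic_grid hD DI DJ) hE).
  have sub K : D K -> K `<=` I -> \int[leb]_(x in K) \1_I x = len K.
    move=> DK KI; rewrite /Rintegral integral_indic; last 2 first.
      exact: (grid_measurable hD).
      exact: (grid_measurable hD).
    by rewrite setIidr.
  rewrite !sub// ?lJ ?subrr ?mulr0//.
  exact: subset_trans J'J JI.
case: (grid_trichotomy hD DI DJ) => // IJ; apply: JI0 => x Jx.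
by apply: contrapT => nIx; apply: nIJ; split => // /(_ x Jx).
Qed.

Lemma product_term_out f I J x : D I -> D J -> ~ I `<` J ->
  product_term f I J x = 0.
Proof.
move=> DI DJ nIJ; rewrite /product_term pairing_indic_out//.
by rewrite /inner_fraction asboolF// !mul0r !addr0.
Qed.

Section integrable_on_grid.
Variable f : R -> R.
Hypothesis mf : measurable_fun [set: R] f.
Hypothesis fD : forall J, D J -> leb.-integrable J (EFin \o f).

(** The expectations of the indicator of [I] and of [f] over [J], multiplied
    together and restricted to [J]. *)
Definition damped_average I J (x : R) : R :=
  len I / len J * average f J * \1_J x.

(** The discrete product rule: with [E'] and [E] the averages over the child and
    the parent, [E'g E'f - Eg Ef] is the sum of [(E'g - Eg) Ef],
    [(E'g - Eg) (E'f - Ef)] and [Eg (E'f - Ef)], here with [g] the indicator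
    of [I].  On the sibling of [J'] the term [E'g] vanishes, which is why only
    [J'] occurs on the right. *)
Lemma product_term_parent I J' J : D I -> D J' -> D J -> I `<=` J' ->
  J' `<=` J -> len J = 2 * len J' ->
  {ae leb, forall x, product_term f I J x =
    damped_average I J' x - damped_average I J x}.
Proof.
move=> DI DJ' DJ IJ' J'J lJ.
have [e e2 hE] := haar_child hD DJ' DJ J'J lJ.
have mI : measurable_fun [set: R] (\1_I : R -> R).
  by apply: measurable_indic; exact: grid_measurable DI.
have IJ : I `<=` J by exact: subset_trans IJ' J'J.
have l0 := grid_len_gt0 hD DJ'.
have sIJ : I `<` J.
  by split => // JI; have := grid_le_len hD DJ DJ' (subset_trans JI IJ'); lra.
have pI := pairing_haar hD DJ' DJ J'J mI (integrable_indic_grid hD DI DJ) hE.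
have pf := pairing_haar hD DJ' DJ J'J mf (fD DJ) hE.
rewrite !(Rintegral_indic_grid hD DI)// in pI.
have : (e * (Num.sqrt (len J))^-1) ^+ 2 = (2 * len J')^-1.
  by rewrite exprMn e2 mul1r exprVn sqr_sqrtr lJ// mulr_ge0// ltW.
move: pI pf hE; set c := e * _ => pI pf hE c2.
apply: filterS hE => x hx; rewrite /product_term /damped_average /inner_fraction.
rewrite asboolT// /average pI pf hx lJ.
move: (\int[leb]_(x in J') f x) (\int[leb]_(x in J) f x) (\1_J' x) (\1_J x).
move=> a A i' i.
transitivity (c ^+ 2 * len I * (A / (2 * len J') * (2 * i' - i)
   + (2 * a - A) * i / (2 * len J') + (2 * a - A) / (2 * len J') * (2 * i' - i))).
  by field; rewrite gt_eqF.
by rewrite c2; field; rewrite gt_eqF.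
Qed.

Lemma telescope_ancestors I n : D I ->
  {ae leb, forall x, \sum_(k < n) product_term f I (iter k.+1 (parent D) I) x =
    average f I * \1_I x - damped_average I (iter n (parent D) I) x}.
Proof.
move=> DI; have l0 := grid_len_gt0 hD DI.
elim: n => [|n IH].
  apply: aeW => x; rewrite big_ord0 /damped_average /= divff ?gt_eqF// mul1r.
  by rewrite subrr.
have [Dn In _] := ancestorP hD n DI.
have [Dp np lp] := parentP hD Dn.
apply: filterS2 IH (product_term_parent DI Dn Dp In np lp) => x IH tE.
by rewrite big_ord_recr/= IH tE addrA subrK.
Qed.

(** Only the members of [H] that strictly contain [I] contribute, and by
    hypothesis they are an initial segment of the ancestors of [I], so that the
    sum telescopes. *)
Lemma telescope_set I (H : set (set R)) (M : R) : D I -> len I <= M ->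
  H `<=` D -> (forall J, D J -> I `<` J -> H J <-> len J <= M) ->
  exists J, [/\ D J, M < 2 * len J & {ae leb, forall x,
    \sum_(K \in H) product_term f I K x =
    average f I * \1_I x - damped_average I J x}].
Proof.
move=> DI IM HD Habove; have l0 := grid_len_gt0 hD DI.
have [n [Mn anc]] := ancestors_below hD DI IM.
have [Dn In _] := ancestorP hD n DI.
exists (iter n (parent D) I); split => //.
apply: filterS (telescope_ancestors n DI) => x <-.
rewrite (fsbig_ord _ n (fun k => product_term f I (iter k.+1 (parent D) I) x)).
rewrite -(@fsbig_image _ _ _ _ _ `I_n (fun k => iter k.+1 (parent D) I)
  (fun J => product_term f I J x)); last first.
  move=> i j _ _ ij.
  have [_ _ li] := ancestorP hD i.+1 DI; have [_ _ lj] := ancestorP hD j.+1 DI.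
  move: li; rewrite ij lj => /(mulIf (lt0r_neq0 l0)) ij2.
  by apply/succn_inj/esym/(@ieexprIn R 2) => //; rewrite pnatr_eq1.
rewrite -anc; apply/esym/fsbig_widen.
  by move=> J [DJ IJ JM]; apply/Habove.
move=> J [HJ nJ] /=; apply: product_term_out => //; first exact: HD.
by move=> IJ; apply: nJ; split => //; [exact: HD|apply/Habove => //; exact: HD].
Qed.

End integrable_on_grid.
End telescoping.

(** * The symbol and the multiplier of a finite collection *)

Section counting_function.
Context {R : realType}.
Implicit Types (I J : set R) (f g : R -> R).
Variables (D : set (set R)) (hD : dyadic_grid D).

Lemma Rintegral_sum (T : eqType) (s : seq T) (u : T -> R -> R) (A : set R) :
  measurable A -> (forall i, i \in s -> leb.-integrable A (EFin \o u i)) ->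
  leb.-integrable A (EFin \o (fun x => \sum_(i <- s) u i x)) /\
  \int[leb]_(x in A) (\sum_(i <- s) u i x) =
  \sum_(i <- s) \int[leb]_(x in A) u i x.
Proof.
move=> mA; elim: s => [|i s IH] us.
  split.
    under eq_fun do rewrite big_nil.
    exact: integrable0.
  under eq_Rintegral do rewrite big_nil.
  by rewrite big_nil /Rintegral integral0.
have [j sj|intS IHs] := IH; first by apply: us; rewrite inE sj orbT.
have iu : leb.-integrable A (EFin \o u i) by apply: us; rewrite inE eqxx.
split.
  under eq_fun do rewrite big_cons.
  exact: (integrableD _ iu intS).
under eq_Rintegral do rewrite big_cons.
by rewrite big_cons RintegralD// IHs.
Qed.

Lemma measurable_sum_seq (T : eqType) (s : seq T) (u : T -> R -> R) :
  (forall i, i \in s -> measurable_fun [set: R] (u i)) ->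
  measurable_fun [set: R] (fun x => \sum_(i <- s) u i x).
Proof.
elim: s => [|i s IH] us.
  by under eq_fun do rewrite big_nil; exact: measurable_cst.
under eq_fun do rewrite big_cons; apply: measurable_funD.
  by apply: us; rewrite inE eqxx.
by apply: IH => j sj; apply: us; rewrite inE sj orbT.
Qed.

Lemma normr_haar J x : `|haar J x| = (Num.sqrt (len J))^-1 * \1_J x.
Proof.
rewrite /haar normrM ger0_norm ?invr_ge0 ?sqrtr_ge0//; congr (_ * _).
rewrite /right_half /left_half !indicE !in_setI.
have -> : (x \in [set z | midpoint J <= z]) = (midpoint J <= x).
  by apply/idP/idP => [/set_mem|h]; last exact: mem_set.
have -> : (x \in [set z | z < midpoint J]) = (x < midpoint J).
  by apply/idP/idP => [/set_mem|h]; last exact: mem_set.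
by case: (x \in J); case: ltP => /= _; rewrite ?subr0 ?sub0r ?subrr ?normrN ?normr1 ?normr0.
Qed.

Lemma integrable_mul_haar f J : D J -> measurable_fun [set: R] f ->
  leb.-integrable J (EFin \o f) ->
  leb.-integrable setT (EFin \o (fun x => f x * haar J x)).
Proof.
move=> DJ mf fJ; have mJ := grid_measurable hD DJ.
pose c := (Num.sqrt (len J))^-1.
have ig : leb.-integrable setT (fun x => c%:E * (f x * \1_J x)%:E)%E.
  by apply: integrableZl => //; exact: integrable_mul_indic.
apply: le_integrable ig => //.
- by apply/measurable_EFinP; apply: measurable_funM => //; exact: (measurable_haar hD).
- move=> x _; rewrite /= lee_fin normrM normr_haar -/c !normrM.
  rewrite (ger0_norm (_ : 0 <= c)) ?invr_ge0 ?sqrtr_ge0//.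
  by rewrite (ger0_norm (_ : 0 <= \1_J x)) ?indicE// mulrCA.
Qed.

(** A function with vanishing norm is almost everywhere constant on [J]; this
    covers the functions [b] that the supremum over [BMO] leaves out. *)
Lemma bmo_norm0_pairing b J : measurable_fun [set: R] b -> D J ->
  leb.-integrable J (EFin \o b) -> bmo_norm D b = 0%E ->
  pairing b (haar J) = 0.
Proof.
move=> mb DJ bJ b0; have mJ := grid_measurable hD DJ.
have l0 := grid_len_gt0 hD DJ.
set m := average b J.
have : ((\int[leb]_(x in J) `|b x - m|%:E) / leb J <= 0)%E.
  by rewrite -b0; apply: ereal_sup_ubound; exists J.
rewrite (grid_leb hD)// inver gt_eqF// => h.
have int0 : (\int[leb]_(x in J) `|(b x - m)%:E| = 0)%E.
  move: h; rewrite pmule_lle0 ?lte_fin ?invr_gt0// => h.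
  by apply/eqP; rewrite eq_le integral_ge0// andbT.
have mbm : measurable_fun J (EFin \o (fun x => b x - m)).
  by apply/measurable_EFinP; apply: measurable_funB => //; exact: measurable_funTS.
have /(ae_eq_integral_abs leb mJ mbm) aeb := int0.
have [x Jx] := grid_neq0 hD DJ.
have [I [DI IJ lJ _]] := grid_child hD DJ Jx.
have [e _ hE] := haar_child hD DI DJ IJ lJ.
rewrite (pairing_haar hD DI DJ IJ mb bJ hE).
have sub K : D K -> K `<=` J -> \int[leb]_(x in K) b x = m * len K.
  move=> DK KJ; rewrite -(Rintegral_cst_grid hD m DK) /Rintegral; congr fine.
  have mK := grid_measurable hD DK.
  apply: ae_eq_integral => //.
  - by apply/measurable_EFinP; exact: measurable_funTS.
  - apply: filterS aeb => y + Ky => /(_ (KJ _ Ky)) /= [] /eqP.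
    by rewrite subr_eq0 => /eqP ->.
by rewrite !sub// lJ; ring.
Qed.

Variables (r : seq (set R)) (rD : forall I, I \in r -> D I).

Definition count_fun (x : R) : R := \sum_(I <- r) \1_I x.

(** The multiplier [tau] for which the sparse operator of [r] is the sum of the
    two paraproducts of [count_fun] and the martingale transform. *)
Definition inner_density J : R := \sum_(I <- r) inner_fraction I J.

Lemma integrable_count_fun J : D J -> leb.-integrable J (EFin \o count_fun).
Proof.
move=> DJ; have mJ := grid_measurable hD DJ.
apply: (Rintegral_sum mJ _).1 => I Ir.
exact: (integrable_indic_grid hD (rD Ir) DJ).
Qed.

Lemma measurable_count_fun : measurable_fun [set: R] count_fun.
Proof.
apply: measurable_sum_seq => I /rD DI.
by apply: measurable_indic; exact: (grid_measurable hD).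
Qed.

Lemma locally_integrable_count_fun : locally_integrable [set: R] count_fun.
Proof.
apply: open_integrable_locally; first exact: openT.
apply: (Rintegral_sum measurableT _).1 => I /rD DI.
have := integrable_mul_indic (grid_measurable hD DI) (integrable_cst_grid hD 1 DI).
by apply: eq_integrable => // x _; rewrite /= mul1r.
Qed.

Lemma pairing_count_fun J : D J ->
  pairing count_fun (haar J) = \sum_(I <- r) pairing \1_I (haar J).
Proof.
move=> DJ; rewrite /pairing /count_fun.
under eq_Rintegral do rewrite big_distrl/=.
apply: (Rintegral_sum measurableT _).2 => I /rD DI.
apply: integrable_mul_haar => //; last exact: (integrable_indic_grid hD).
by apply: measurable_indic; exact: (grid_measurable hD).
Qed.

Section carleson.
Variables (Lambda : R) (L0 : 0 < Lambda).
Hypothesis rC : forall J, D J ->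
  \sum_(I <- r | `[< I `<=` J >]) len I <= Lambda * len J.

Lemma inner_density_ge0 J : D J -> 0 <= inner_density J.
Proof.
move=> DJ; rewrite /inner_density big_seq; apply: sumr_ge0 => I /rD DI.
rewrite /inner_fraction; case: asboolP => // _.
by rewrite divr_ge0// ltW// (grid_len_gt0 hD).
Qed.

Lemma inner_density_le J : D J -> inner_density J <= Lambda.
Proof.
move=> DJ; have l0 := grid_len_gt0 hD DJ.
rewrite -(ler_pM2r l0); apply: le_trans (rC DJ).
rewrite /inner_density mulr_suml [leRHS]big_mkcond/= big_seq [leRHS]big_seq.
apply: ler_sum => I /rD DI; have lI := grid_len_gt0 hD DI.
rewrite /inner_fraction; case: asboolP => [[IJ _]|_].
  by rewrite asboolT// divfK ?gt_eqF.
by rewrite mul0r; case: asboolP => // _; exact: ltW.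
Qed.

(** Seen from [J], the intervals of [r] that are not inside [J] add a
    constant. *)
Lemma count_fun_split J x : D J -> J x ->
  count_fun x = \sum_(I <- r | `[< I `<=` J >]) \1_I x +
    \sum_(I <- r | ~~ `[< I `<=` J >]) (`[< J `<=` I >])%:R.
Proof.
move=> DJ Jx; rewrite /count_fun (bigID (fun I => `[< I `<=` J >]))/=.
congr (_ + _); rewrite big_seq_cond [RHS]big_seq_cond.
apply: eq_bigr => I /andP[/rD DI /asboolP nIJ]; rewrite indicE.
case: asboolP => [/(_ x Jx) Ix|nJI]; first by rewrite mem_set.
rewrite memNset// => Ix.
case: (grid_trichotomy hD DI DJ) => // IJ0.
by have : (I `&` J) x by []; rewrite IJ0.
Qed.

Lemma integrable_oscillation J : D J -> leb.-integrable J
  (EFin \o (fun x => `|count_fun x - average count_fun J|)).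
Proof.
move=> DJ; have mJ := grid_measurable hD DJ.
apply: (@integrable_abse _ _ _ leb J
  (EFin \o (fun x => count_fun x - average count_fun J))).
exact: (integrableB _ (integrable_count_fun DJ)
  (integrable_cst_grid hD (average count_fun J) DJ)).
Qed.

(** Let [X] be the part of the counting function coming from intervals inside
    [J], and [m] its average, at most [Lambda].  Nestedness and the Carleson
    condition at each [I] give [<X^2> <= 2 Lambda m], so the variance of [X] is
    at most [2 Lambda m - m^2 <= Lambda^2], and the mean oscillation is at
    most [Lambda].  Bounding it by [2 m] instead would lose a factor [2] in the
    theorem. *)
Lemma oscillation_count_fun J : D J ->
  \int[leb]_(x in J) `|count_fun x - average count_fun J| <= Lambda * len J.
Proof.
move=> DJ; have mJ := grid_measurable hD DJ; have l0 := grid_len_gt0 hD DJ.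
pose sJ := [seq I <- r | `[< I `<=` J >]].
have sJP I : I \in sJ -> D I /\ I `<=` J.
  by rewrite mem_filter => /andP[/asboolP IJ /rD].
pose X x : R := \sum_(I <- sJ) \1_I x.
pose c : R := \sum_(I <- r | ~~ `[< I `<=` J >]) (`[< J `<=` I >])%:R.
have bE x : J x -> count_fun x = X x + c.
  by move=> Jx; rewrite (count_fun_split DJ Jx) /X /sJ big_filter.
have iI (s : seq (set R)) I : {subset s <= sJ} -> I \in s ->
    leb.-integrable J (EFin \o (\1_I : R -> R)).
  by move=> ss /ss/sJP[DI _]; exact: (integrable_indic_grid hD).
have sumI (s : seq (set R)) : {subset s <= sJ} ->
    leb.-integrable J (EFin \o (fun x => \sum_(I <- s) \1_I x : R)) /\
    \int[leb]_(x in J) (\sum_(I <- s) \1_I x) = \sum_(I <- s) len I.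
  move=> ss; have [intS ->] := Rintegral_sum mJ (fun I => @iI s I ss).
  split => //; rewrite big_seq [RHS]big_seq; apply: eq_bigr => I /ss/sJP[DI IJ].
  exact: (Rintegral_indic_grid hD).
have [iX intX] := sumI sJ (fun I h => h).
pose m := (\sum_(I <- sJ) len I) / len J.
have mE : average count_fun J = m + c.
  rewrite /average (_ : \int[leb]_(x in J) count_fun x =
    \int[leb]_(x in J) (X x + cst c x)); last first.
    by apply: eq_Rintegral => x /set_mem Jx; rewrite bE.
  rewrite RintegralD//; last exact: (integrable_cst_grid hD).
  by rewrite intX (Rintegral_cst_grid hD)// mulrDl mulfK ?gt_eqF.
(* In X^2 each pair of intervals is nested or disjoint; pairs are counted
   according to which of the two is contained in the other. *)
pose Y x : R := \sum_(I <- sJ) \sum_(K <- sJ | `[< K `<=` I >]) \1_K x.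
have X2Y x : X x ^+ 2 <= 2 * Y x.
  have -> : X x ^+ 2 = \sum_(I <- sJ) \sum_(K <- sJ) \1_I x * \1_K x.
    rewrite expr2 {1}/X big_distrl/=; apply: eq_bigr => I _.
    by rewrite big_distrr.
  have YE : Y x = \sum_(I <- sJ) \sum_(K <- sJ | `[< I `<=` K >]) \1_I x.
    rewrite /Y; under eq_bigr do rewrite big_mkcond/=.
    by rewrite exchange_big/=; apply: eq_bigr => I _; rewrite [RHS]big_mkcond.
  rewrite mulr_natl mulr2n {2}YE {1}/Y -big_split/= big_seq [leRHS]big_seq.
  apply: ler_sum => I /sJP[DI _].
  rewrite [X in _ <= X + _]big_mkcond [X in _ <= _ + X]big_mkcond -big_split/=.
  rewrite big_seq [leRHS]big_seq; apply: ler_sum => K /sJP[DK _].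
  have i0 (A : set R) : 0 <= \1_A x :> R by rewrite indicE.
  have i1 (A : set R) : \1_A x <= 1 :> R by rewrite indicE lern1 leq_b1.
  case: asboolP => [KI|nKI].
    apply: ler_wpDr; first by case: asboolP.
    by rewrite -[leRHS]mul1r ler_wpM2r.
  case: asboolP => [IK|nIK].
    by rewrite add0r -[leRHS]mulr1 ler_wpM2l.
  case: (grid_trichotomy hD DI DK) => // IK0.
  rewrite !indicE addr0; case: (boolP (x \in I)) => [/set_mem Ix|]; last by rewrite mul0r.
  rewrite memNset ?mulr0// => Kx.
  by have : (I `&` K) x by []; rewrite IK0.
have [iY intY] : leb.-integrable J (EFin \o Y) /\
    \int[leb]_(x in J) Y x = \sum_(I <- sJ) \sum_(K <- sJ | `[< K `<=` I >]) len K.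
  have sub I : {subset [seq K <- sJ | `[< K `<=` I >]] <= sJ}.
    by move=> K; rewrite mem_filter => /andP[].
  pose u I x : R := \sum_(K <- sJ | `[< K `<=` I >]) \1_K x.
  have ui I : leb.-integrable J (EFin \o u I) /\
      \int[leb]_(x in J) u I x = \sum_(K <- sJ | `[< K `<=` I >]) len K.
    have [] := sumI _ (@sub I); rewrite big_filter => h1 h2; split.
      by move: h1; apply: eq_integrable => // x _ /=; rewrite big_filter.
    by rewrite -h2; apply: eq_Rintegral => x _; rewrite big_filter.
  have [iu ->] := Rintegral_sum mJ (fun I (_ : I \in sJ) => (ui I).1).
  by split => //; apply: eq_bigr => I _; rewrite (ui I).2.
set a := \int[leb]_(x in J) Y x in intY.
have mL : \int[leb]_(x in J) X x = m * len J by rewrite intX /m divfK ?gt_eqF.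
have aL : a <= Lambda * (m * len J).
  rewrite intY -mL intX mulr_sumr big_seq [leRHS]big_seq.
  apply: ler_sum => I /sJP[DI IJ]; apply: le_trans (rC DI).
  rewrite big_filter_cond [leLHS]big_mkcond [leRHS]big_mkcond/= big_seq [leRHS]big_seq.
  apply: ler_sum => K /rD DK; have lK := grid_len_gt0 hD DK.
  case: (asboolP (K `<=` I)) => KI; last by rewrite andbF.
  by rewrite andbT; case: ifP => // _; exact: ltW.
(* G bounds |X - m| pointwise, by |t| <= (t^2 / Lambda + Lambda) / 2 and
   X^2 <= 2 Y. *)
pose G x := Lambda^-1 * Y x + - (Lambda^-1 * m) * X x +
   cst (m ^+ 2 / (2 * Lambda) + Lambda / 2) x.
have iG1 : leb.-integrable J (EFin \o (fun x => Lambda^-1 * Y x)).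
  exact: integrableZl iY.
have iG2 : leb.-integrable J (EFin \o (fun x => - (Lambda^-1 * m) * X x)).
  exact: integrableZl iX.
have iG12 : leb.-integrable J
    (EFin \o (fun x => Lambda^-1 * Y x + - (Lambda^-1 * m) * X x)).
  exact: (integrableD _ iG1 iG2).
have iG3 := integrable_cst_grid hD (m ^+ 2 / (2 * Lambda) + Lambda / 2) DJ.
have intG : \int[leb]_(x in J) G x = Lambda^-1 * a - (Lambda^-1 * m) * (m * len J)
    + (m ^+ 2 / (2 * Lambda) + Lambda / 2) * len J.
  rewrite /G RintegralD//.
  rewrite RintegralD// !RintegralZl// (Rintegral_cst_grid hD)// mL mulNr//.
have ibm := integrable_oscillation DJ.
apply: (@le_trans _ _ (\int[leb]_(x in J) G x)).
  apply: le_Rintegral => //; first exact: (integrableD _ iG12 iG3).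
  move=> x Jx; rewrite mE bE// opprD addrACA subrr addr0 /G.
  have [LV L2] : Lambda^-1 * Lambda = 1 /\ 0 < Lambda^-1.
    by rewrite mulVf ?gt_eqF// invr_gt0.
  have := X2Y x; set y := Y x; set z := X x => zy.
  have -> : m ^+ 2 / (2 * Lambda) = Lambda^-1 * m ^+ 2 / 2 by field; rewrite gt_eqF.
  apply: (@le_trans _ _ (Lambda^-1 * (z - m) ^+ 2 / 2 + Lambda / 2)); last first.
    have : 0 <= Lambda^-1 * (2 * y - z ^+ 2) by rewrite mulr_ge0 ?subr_ge0// ltW.
    rewrite /cst; set k := Lambda^-1; nra.
  have h : 0 <= Lambda^-1 * (`|z - m| - Lambda) ^+ 2 by rewrite mulr_ge0 ?sqr_ge0// ltW.
  rewrite -real_normK ?num_real//; move: LV h; set k := Lambda^-1.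
  set t := `|z - m| => LV h.
  have : k * (t - Lambda) ^+ 2 = k * t ^+ 2 - 2 * t * (k * Lambda) + (k * Lambda) * Lambda.
    by ring.
  rewrite LV => hE; rewrite hE in h; lra.
rewrite intG.
have m0 : 0 <= (Lambda - m) ^+ 2 by exact: sqr_ge0.
have aL' : Lambda^-1 * a <= m * len J.
  by rewrite ler_pdivrMl.
have -> : Lambda^-1 * a - Lambda^-1 * m * (m * len J) +
  (m ^+ 2 / (2 * Lambda) + Lambda / 2) * len J =
  Lambda^-1 * a + (Lambda / 2 - m ^+ 2 / (2 * Lambda)) * len J.
  by field; rewrite gt_eqF.
apply: (@le_trans _ _ ((m + (Lambda / 2 - m ^+ 2 / (2 * Lambda))) * len J)).
  by rewrite [leRHS]mulrDl lerD2r.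
rewrite ler_pM2r// -subr_ge0.
have -> : Lambda - (m + (Lambda / 2 - m ^+ 2 / (2 * Lambda))) =
  (Lambda - m) ^+ 2 / (2 * Lambda) by field; rewrite gt_eqF.
by rewrite divr_ge0// mulr_ge0// ltW.
Qed.

Lemma bmo_norm_count_fun : (bmo_norm D count_fun <= Lambda%:E)%E.
Proof.
apply: ge_ereal_sup => _ [J DJ <-]; have mJ := grid_measurable hD DJ.
have l0 := grid_len_gt0 hD DJ.
rewrite (grid_leb hD)// inver gt_eqF// lee_pdivrMr//.
have := oscillation_count_fun DJ; rewrite -lee_fin EFinM => /(le_trans _); apply.
rewrite /Rintegral fineK//.
by apply: integrable_fin_num => //; exact: integrable_oscillation.
Qed.

Lemma BMO_count_fun : BMO D count_fun.
Proof.
split; first exact: locally_integrable_count_fun.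
exact: le_lt_trans bmo_norm_count_fun (ltry _).
Qed.

Lemma sup_norm_inner_density : (sup_norm D inner_density <= Lambda%:E)%E.
Proof.
apply: ge_ereal_sup => _ [J DJ <-]; rewrite lee_fin.
by rewrite ger0_norm ?inner_density_le ?inner_density_ge0.
Qed.

End carleson.
End counting_function.

(** * Finite collections *)

Section finite_collections.
Context {R : realType}.
Implicit Types (I J : set R) (f g : R -> R).
Variables (D : set (set R)) (hD : dyadic_grid D).
Variables (w : weight R) (p : R) (p1 : 1 < p) (hw : Ap_weight D p w).

Lemma ae_seq (T : eqType) (s : seq T) (P : T -> R -> Prop) :
  (forall i, i \in s -> {ae leb, forall x, P i x}) ->
  {ae leb, forall x, forall i, i \in s -> P i x}.
Proof.
elim: s => [|i s IH] Ps; first by apply: aeW.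
have Pi : {ae leb, forall x, P i x} by apply: Ps; rewrite inE eqxx.
have : {ae leb, forall x, forall i, i \in s -> P i x}.
  by apply: IH => j sj; apply: Ps; rewrite inE sj orbT.
by apply: filterS2 Pi => x Pix Psx j; rewrite inE => /predU1P[->|/Psx].
Qed.

(** The factor [len I / len J] is what makes the remainder of the telescoping
    sums tend to zero. *)
Lemma Lp_norm_damped_average K f I J : D I -> D J -> Lp w p f -> 0 <= K ->
  leb.-integrable J (EFin \o f) ->
  (Lp_norm w p (fun x => (average (fun y => `|f y|) J * \1_J x)%R)
   <= K%:E * Lp_norm w p f)%E ->
  (Lp_norm w p (damped_average f I J)
   <= (len I / len J * K)%:E * Lp_norm w p f)%E.
Proof.
move=> DI DJ /LpE[mf lf] K0 fJ Kle.
have mJ := grid_measurable hD DJ; have lJ := grid_len_gt0 hD DJ.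
have lI := grid_len_gt0 hD DI; have p0 : 0 < p := lt_trans ltr01 p1.
have mJ1 : measurable_fun [set: R] (\1_J : R -> R) by exact: measurable_indic.
have c0 : 0 <= len I / len J by rewrite divr_ge0// ltW.
set h := fun x => _ in Kle.
have mh : measurable_fun [set: R] h by exact: measurable_funM.
apply: (@le_trans _ _ (Lp_norm w p (fun x => len I / len J * h x))).
  apply: Lp_norm_le => //; try exact: measurable_funM.
  move=> x; rewrite /damped_average /h !normrM !mulrA ler_wpM2r//.
  rewrite ler_wpM2r// ler_wpM2l ?mulr_ge0//.
  by apply: le_trans (le_normr_Rintegral _ fJ) _ => //; exact: ler_norm.
rewrite Lp_normZ// ger0_norm// (EFinM _ K) -muleA.
by rewrite lee_wpmul2l ?lee_fin.
Qed.

Lemma len_seq_bound (s : seq (set R)) : exists M : R, forall J, J \in s -> len J <= M.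
Proof.
elim: s => [|I s [M HM]]; first by exists 0.
exists (Num.max (len I) M) => J; rewrite inE => /predU1P[->|/HM h].
  by rewrite le_max lexx.
by rewrite le_max h orbT.
Qed.

Variables (r : seq (set R)) (rD : forall I, I \in r -> D I).

(** Unconditional convergence of the three series is convergence along finite
    sets of intervals, but the sums telescope only along chains without gaps.
    Every finite set can be enlarged to one that contains all the ancestors, up
    to a common length [M], of the intervals of [r]; the error [d] is then a sum
    of averages damped by a factor of order [1 / M]. *)
Lemma telescope_net f (G : set (set R)) (e : R) : Lp w p f -> fsets D G -> 0 < e ->
  exists H d, [/\ fsets D H, G `<=` H, measurable_fun [set: R] d,
    (Lp_norm w p d <= e%:E)%E &
    {ae leb, forall x, \sum_(J \in H) \sum_(I <- r) product_term f I J x =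
      \sum_(I <- r) average f I * \1_I x - d x}].
Proof.
move=> Lf [finG GD] e0.
have [K K0 HK] := grid_Ap hD p1 hw.
have /LpE[mf lf] := Lf.
have fD J : D J -> leb.-integrable J (EFin \o f) by move=> DJ; have [] := HK _ _ DJ Lf.
have [M1 HM1] := len_seq_bound (finmap.enum_fset (fset_set G) ++ r).
have [N NE] := ge0_neqy_EFin (Lp_norm_ge0 w p f) (negbT (lt_eqF lf)).
have N0 : 0 <= N by rewrite -lee_fin -NE; exact: Lp_norm_ge0.
pose Sr := \sum_(I <- r) len I.
have Sr0 : 0 <= Sr.
  by rewrite /Sr big_seq; apply: sumr_ge0 => I /rD DI; rewrite ltW// (grid_len_gt0 hD).
(* The last summand makes the total norm of the remainders at most e; the
   others ensure that M is positive and bounds the lengths in r and G. *)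
pose M := `|M1| + 1 + 2 * K * N * Sr / e.
have q0 : 0 <= 2 * K * N * Sr / e by apply: divr_ge0; [rewrite !mulr_ge0|exact: ltW].
have M0 : 0 < M by rewrite /M; have := normr_ge0 M1; lra.
have M1M : M1 <= M by rewrite /M; have := ler_norm M1; lra.
have Me : 2 * K * N * Sr / M <= e.
  rewrite ler_pdivrMr// -ler_pdivrMl// mulrC /M.
  by have := normr_ge0 M1; lra.
pose A I := [set J | [/\ D J, I `<` J & len J <= M]].
pose H := G `|` \bigcup_(I in [set` r]) A I.
have rM I : I \in r -> len I <= M.
  by move=> Ir; apply: le_trans M1M; apply: HM1; rewrite mem_cat Ir orbT.
have HD : H `<=` D by move=> J [/GD//|[I _ []]].
have finH : finite_set H.
  rewrite finite_setU; split => //; apply: bigcup_finite => // I /= Ir.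
  rewrite /A; have [n [_ ->]] := ancestors_below hD (rD Ir) (rM I Ir).
  exact/finite_image/finite_II.
have HM J : H J -> len J <= M.
  move=> [GJ|[I _ [] //]]; apply: le_trans M1M; apply: HM1.
  by rewrite mem_cat in_fset_set// mem_set.
have /choice[P HP] : forall I, exists J, I \in r -> [/\ D J, M < 2 * len J &
    {ae leb, forall x, \sum_(K \in H) product_term f I K x =
     average f I * \1_I x - damped_average f I J x}].
  move=> I; have [Ir|] := boolP (I \in r); last by exists set0.
  have [J HJ] := telescope_set hD mf fD (rD Ir) (rM I Ir) HD
    (fun J DJ IJ => conj (@HM J) (fun JM => or_intror (ex_intro2 _ _ I Ir (And3 DJ IJ JM)))).
  by exists J.
have mdamp I : I \in r -> measurable_fun [set: R] (damped_average f I (P I)).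
  move=> Ir; have [DP _ _] := HP I Ir; apply: measurable_funM => //.
  by apply: measurable_indic; exact: (grid_measurable hD).
exists H, (fun x => \sum_(I <- r) damped_average f I (P I) x).
split => //; first by move=> J GJ; left.
- exact: measurable_sum_seq.
- have dle I : I \in r ->
    (Lp_norm w p (damped_average f I (P I)) <= (2 * K * N * len I / M)%:E)%E.
    move=> Ir; have [DP MP _] := HP I Ir; have lI := grid_len_gt0 hD (rD Ir).
    have [fP KP] := HK _ _ DP Lf; have lP := grid_len_gt0 hD DP.
    apply: le_trans (Lp_norm_damped_average (rD Ir) DP Lf K0 fP KP) _.
    rewrite NE -EFinM lee_fin.
    have -> : 2 * K * N * len I / M = len I * (2 / M) * K * N by ring.
    rewrite !ler_wpM2r// ler_pM2l// ler_pdivlMr// mulrC.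
    by rewrite ler_pdivrMr// mulrC ltW// mulrC.
  have h (s : seq (set R)) : {subset s <= r} ->
      (Lp_norm w p (fun x => (\sum_(I <- s) damped_average f I (P I) x)%R)
       <= (2 * K * N / M * \sum_(I <- s) len I)%:E)%E.
    elim: s => [_|I s IH sr].
      under eq_fun do rewrite big_nil.
      by rewrite big_nil mulr0 Lp_norm0 ?(lt_trans ltr01 p1).
    under eq_fun do rewrite big_cons.
    have Ir : I \in r by apply: sr; rewrite inE eqxx.
    have sr' : {subset s <= r} by move=> J Js; apply: sr; rewrite inE Js orbT.
    apply: le_trans (Lp_normD _ (ltW p1) _ _) _.
    - exact: mdamp.
    - by apply: measurable_sum_seq => J Js; apply: mdamp; exact: sr'.
    rewrite big_cons mulrDr EFinD leeD ?IH//.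
    by apply: le_trans (dle I Ir) _; rewrite lee_fin mulrAC.
  apply: le_trans (h r _) _ => //; rewrite lee_fin.
  by rewrite -/Sr mulrAC.
have aeP : {ae leb, forall x, forall I, I \in r ->
    \sum_(K \in H) product_term f I K x =
    average f I * \1_I x - damped_average f I (P I) x}.
  by apply: ae_seq => I Ir; have [] := HP I Ir.
apply: filterS aeP => x Hx.
rewrite -sumrB [RHS]big_seq -(eq_bigr _ (fun I Ir => Hx I Ir)) -big_seq.
rewrite fsbig_finite// exchange_big/=; apply: eq_bigr => I _.
by rewrite fsbig_finite.
Qed.

Lemma op_norm_witness T (c : R) : (op_norm w p T < c%:E)%E ->
  forall f, Lp w p f -> exists g,
    [/\ Lp w p g, T f g & (Lp_norm w p g <= c%:E * Lp_norm w p f)%E].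
Proof.
move=> /ereal_inf_lt[_ [C [C0 HC] <-]]; rewrite lte_fin => Cc f /HC[g [Lg Tfg gf]].
exists g; split => //; apply: le_trans gf _.
by rewrite lee_wpmul2r ?Lp_norm_ge0// lee_fin ltW.
Qed.

Lemma sum_product_term f J x : D J ->
  \sum_(I <- r) product_term f I J x =
  pairing (count_fun r) (haar J) * average f J * haar J x +
  pairing (count_fun r) (haar J) * pairing f (haar J) * (\1_J x / len J) +
  inner_density r J * pairing f (haar J) * haar J x.
Proof.
move=> DJ; rewrite (pairing_count_fun hD rD DJ) /inner_density.
by rewrite !mulr_suml -!big_split.
Qed.

(** The triangle inequality, applied to a partial sum beyond the index after
    which the partial sums are [e]-close to [g]. *)
Lemma Lp_norm_partial_sum (A : set (set R)) (u : set R -> R -> R) g (H F0 : set (set R))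
    (e : R) :
  (forall J, A J -> measurable_fun [set: R] (u J)) -> Lp w p g ->
  (forall F, fsets A F -> F0 `<=` F ->
    (Lp_norm w p (fun x => (g x - \sum_(J \in F) u J x)%R) < e%:E)%E) ->
  fsets A H -> F0 `<=` H ->
  measurable_fun [set: R] (fun x => \sum_(J \in H) u J x) /\
  (Lp_norm w p (fun x => (\sum_(J \in H) u J x)%R) <= Lp_norm w p g + e%:E)%E.
Proof.
move=> mu /LpE[mg lg] cvg [finH HA] F0H.
have ms : measurable_fun [set: R] (fun x => \sum_(J \in H) u J x).
  under eq_fun do rewrite fsbig_finite//.
  apply: measurable_sum_seq => J; rewrite in_fset_set// => /set_mem/HA.
  exact: mu.
split => //.
have -> : (fun x => \sum_(J \in H) u J x) =
    (fun x => g x - (g x - \sum_(J \in H) u J x)).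
  by apply/funext => x; rewrite subKr.
apply: le_trans (Lp_normB _ (ltW p1) mg (measurable_funB mg ms)) _.
by rewrite leeD2l// ltW// cvg.
Qed.

(** On a finite collection the sparse operator is the sum of the two
    paraproducts and of the martingale transform: along the sets of
    [telescope_net] the partial sums of the three series add up to the sparse
    operator up to a small error. *)
Lemma finite_sparse_bound (a b c : R) f : Lp w p f ->
  (op_norm w p (paraproduct w p D (count_fun r)) <= a%:E)%E ->
  (op_norm w p (adjoint_paraproduct w p D (count_fun r)) <= b%:E)%E ->
  (op_norm w p (martingale_transform w p D (inner_density r)) <= c%:E)%E ->
  (Lp_norm w p (fun x => (\sum_(I <- r) average f I * \1_I x)%R)
   <= (a + b + c)%:E * Lp_norm w p f)%E.
Proof.
move=> Lf ha hb hc; have /LpE[mf lf] := Lf.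
have p0 : 0 < p := lt_trans ltr01 p1.
have [N NE] := ge0_neqy_EFin (Lp_norm_ge0 w p f) (negbT (lt_eqF lf)).
have N0 : 0 <= N by rewrite -lee_fin -NE; exact: Lp_norm_ge0.
rewrite NE; apply/lee_addgt0Pr => e e0.
(* Each operator norm costs an excess d N, and each of the three series and the
   remainder an error d. *)
pose d := e / (3 * N + 4).
have d0 : 0 < d by rewrite divr_gt0//; lra.
have de : 3 * N * d + 4 * d = e by rewrite /d; field; apply/eqP; lra.
have lt x (y : R) : (x <= y%:E -> x < (y + d)%:E)%E.
  by move=> /le_lt_trans; apply; rewrite lte_fin ltrDl.
have mh J : D J -> measurable_fun [set: R] (haar J) by exact: measurable_haar.
have m1 J : D J -> measurable_fun [set: R] (\1_J : R -> R).
  by move=> DJ; apply: measurable_indic; exact: (grid_measurable hD).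
have [g1 [Lg1 [_ cvg1] ng1]] := op_norm_witness (lt _ _ ha) Lf.
have [g2 [Lg2 [_ cvg2] ng2]] := op_norm_witness (lt _ _ hb) Lf.
have [g3 [Lg3 [_ cvg3] ng3]] := op_norm_witness (lt _ _ hc) Lf.
have [F1 [fF1 F1D] cvgF1] := cvg1 _ d0.
have [F2 [fF2 F2D] cvgF2] := cvg2 _ d0.
have [F3 [fF3 F3D] cvgF3] := cvg3 _ d0.
have FD : fsets D (F1 `|` F2 `|` F3).
  split; first by rewrite !finite_setU.
  by move=> J [[/F1D|/F2D]|/F3D].
have [H [rem [HD FH mrem nrem aeE]]] := telescope_net Lf FD d0.
have [ms1 ns1] := Lp_norm_partial_sum
  (fun J DJ => measurable_funM (measurable_cst _) (mh J DJ)) Lg1 cvgF1 HD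
  (subset_trans (fun J h => or_introl (or_introl h)) FH).
have [ms2 ns2] := Lp_norm_partial_sum
  (fun J DJ => measurable_funM (measurable_cst _)
     (measurable_funM (m1 J DJ) (measurable_cst _))) Lg2 cvgF2 HD
  (subset_trans (fun J h => or_introl (or_intror h)) FH).
have [ms3 ns3] := Lp_norm_partial_sum
  (fun J DJ => measurable_funM (measurable_cst _) (mh J DJ)) Lg3 cvgF3 HD
  (subset_trans (fun J h => or_intror h) FH).
move: ms1 ns1 ms2 ns2 ms3 ns3.
set s1 := fun x => _; set s2 := fun x => _; set s3 := fun x => _.
move=> ms1 ns1 ms2 ns2 ms3 ns3.
have -> : Lp_norm w p (fun x => (\sum_(I <- r) average f I * \1_I x)%R) =
    Lp_norm w p (fun x => (s1 x + s2 x + s3 x + rem x)%R).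
  apply: Lp_norm_ae_eq => //.
  - apply: measurable_sum_seq => I /rD DI; apply: measurable_funM => //.
    exact: m1.
  - apply: measurable_funD => //; apply: measurable_funD => //.
    exact: measurable_funD.
  apply: filterS aeE => x E.
  rewrite -[LHS](subrK (rem x)) -E; congr (_ + _).
  have [finH HsubD] := HD.
  rewrite /s1 /s2 /s3 !fsbig_finite// -!big_split/= big_seq [RHS]big_seq.
  apply: eq_bigr => J; rewrite in_fset_set// => /set_mem/HsubD DJ.
  exact: sum_product_term.
have ms12 : measurable_fun [set: R] (fun x => s1 x + s2 x) by exact: measurable_funD.
have ms123 : measurable_fun [set: R] (fun x => s1 x + s2 x + s3 x).
  exact: measurable_funD.
apply: le_trans (Lp_normD _ (ltW p1) ms123 mrem) _.
apply: le_trans (leeD (Lp_normD _ (ltW p1) ms12 ms3) nrem) _.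
apply: le_trans (leeD (leeD (Lp_normD _ (ltW p1) ms1 ms2) (lexx _)) (lexx _)) _.
apply: le_trans (leeD (leeD (leeD ns1 ns2) ns3) (lexx _)) _.
apply: le_trans (leeD (leeD (leeD (leeD ng1 (lexx _)) (leeD ng2 (lexx _)))
  (leeD ng3 (lexx _))) (lexx _)) _.
rewrite NE -!EFinM -!EFinD lee_fin -de; lra.
Qed.

End finite_collections.

(** * Unconditional sums of nonnegative functions *)

Section unconditional_sums.
Context {R : realType} (w : weight R) (p : R).
Hypothesis p1 : 1 < p.
Implicit Types (S F : set (set R)) (u : set R -> R -> R) (f g : R -> R).

Let p0 : 0 < p := lt_trans ltr01 p1.

Lemma powR_seq_cvg0 (t : R ^nat) : (forall n, 0 <= t n) ->
  t @ \oo --> 0 -> (t n `^ p) @[n --> \oo] --> 0.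
Proof.
move=> t0 /cvgrPdist_le tcvg; apply/cvgrPdist_le => e e0.
have e'0 : 0 < e `^ p^-1 by exact: powR_gt0.
have := tcvg _ e'0; apply: filterS => n.
rewrite !sub0r !normrN (ger0_norm (t0 n)) (ger0_norm (powR_ge0 _ _)) => te.
have -> : e = (e `^ p^-1) `^ p by rewrite -powRrM mulVf ?gt_eqF// powRr1// ltW.
by apply: ge0_ler_powR; rewrite ?nnegrE ?powR_ge0// ltW.
Qed.

Lemma measurable_fsum (F : set (set R)) u : finite_set F ->
  (forall I, F I -> measurable_fun [set: R] (u I)) ->
  measurable_fun [set: R] (fun x => \sum_(I \in F) u I x).
Proof.
move=> finF mu; under eq_fun do rewrite fsbig_finite//.
by apply: measurable_sum_seq => I; rewrite in_fset_set// => /set_mem/mu.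
Qed.

Lemma fsum_subset_le (F G : set (set R)) (a : set R -> R) :
  finite_set F -> finite_set G -> F `<=` G -> (forall I, G I -> 0 <= a I) ->
  \sum_(I \in F) a I <= \sum_(I \in G) a I.
Proof.
move=> finF finG FG a0; rewrite -lee_fin -!fsumEFin//.
apply: lee_fsum_nneg_subset => //; first by move=> I /set_mem/FG/mem_set.
by move=> I; rewrite inE/= => /andP[_ /set_mem/a0]; rewrite lee_fin.
Qed.

Lemma countable_exhaustion S : countable S -> exists F : nat -> set (set R),
  [/\ forall n, fsets S (F n), {homo F : m n / (m <= n)%N >-> m `<=` n} &
      forall G, fsets S G -> exists n, G `<=` F n].
Proof.
move=> /countable_injP[phi phi_inj].
pose F n := S `&` [set I | (phi I < n)%N].
have Fhomo : {homo F : m n / (m <= n)%N >-> m `<=` n}.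
  by move=> m n mn I [SI /= Im]; split => //=; exact: leq_trans Im mn.
exists F; split => //.
- move=> n; split; last by move=> I [].
  pose e k := xget set0 [set I | S I /\ phi I = k].
  apply: (@sub_finite_set _ _ (e @` `I_n)); last exact/finite_image/finite_II.
  move=> I [SI In]; exists (phi I) => //.
  have [Se pe] : S (e (phi I)) /\ phi (e (phi I)) = phi I.
    exact: (@xgetI _ set0 [set K | S K /\ phi K = phi I] I).
  by apply: phi_inj => //; exact: mem_set.
- move=> G [finG GS].
  suff [n Hn] : exists n, forall I, I \in finmap.enum_fset (fset_set G) -> (phi I < n)%N.
    exists n => I GI; split; first exact: GS.
    by apply: Hn; rewrite in_fset_set// mem_set.
  elim: (finmap.enum_fset _) => [|I s [n Hn]]; first by exists 0%N.
  exists (maxn n (phi I).+1) => K; rewrite inE => /predU1P[->|/Hn Kn].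
    by rewrite leq_max leqnn orbT.
  by rewrite leq_max Kn.
Qed.

(** For nonnegative terms a bound on the finite partial sums is enough.
    Exhausting [S] by finite sets, monotone convergence bounds the limit and
    dominated convergence makes the tails small in norm; a finite set that
    contains one of the exhausting sets does at least as well, by
    nonnegativity. *)
Lemma Lp_sum_nonneg S u (B : R) : countable S ->
  (forall I, S I -> measurable_fun [set: R] (u I)) ->
  (forall I x, S I -> 0 <= u I x) ->
  (forall F, fsets S F -> (Lp_norm w p (fun x => (\sum_(I \in F) u I x)%R) <= B%:E)%E) ->
  exists g, Lp_sum w p S u g.
Proof.
move=> cS mu u0 uB.
have [F [FS Fhomo Fex]] := countable_exhaustion cS.
pose G n x : R := \sum_(I \in F n) u I x.
have mG n : measurable_fun [set: R] (G n).
  have [finF FnS] := FS n; apply: measurable_fsum => // I /FnS; exact: mu.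
have G0 n x : 0 <= G n x by apply: fsumr_ge0 => I; have [_ FnS] := FS n => /FnS/u0.
have Gnd x : {homo G ^~ x : m n / (m <= n)%N >-> m <= n}.
  move=> m n mn; have [fm _] := FS m; have [fn fnS] := FS n.
  by apply: fsum_subset_le => //; [exact: Fhomo|move=> I /fnS/u0].
have GEnd x : nondecreasing_seq (fun n => (G n x)%:E).
  by move=> m n mn; rewrite lee_fin; exact: Gnd.
pose Gs x := limn (fun n => (G n x)%:E).
have Gcvg x : (G n x)%:E @[n --> \oo] --> Gs x.
  by rewrite /Gs; exact: ereal_nondecreasing_is_cvgn.
have mGs : measurable_fun [set: R] Gs.
  apply: (emeasurable_fun_cvg (fun n x => (G n x)%:E)) => // n.
  exact/measurable_EFinP.
pose g x := fine (Gs x).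
have mg : measurable_fun [set: R] g.
  by apply: measurableT_comp => //; exact: fine_measurable.
have GGs n x : ((G n x)%:E <= Gs x)%E.
  apply: lime_ge; first exact: ereal_nondecreasing_is_cvgn.
  by exists n => // m /= nm; exact: GEnd.
(* Monotone convergence is applied to the powers; finiteness of their limit
   makes the sums themselves bounded, hence convergent, almost everywhere. *)
pose h n x := (G n x `^ p)%:E.
have hnd x : nondecreasing_seq (h ^~ x).
  move=> m n mn; rewrite lee_fin.
  by apply: ge0_ler_powR; rewrite ?nnegrE ?(ltW p0)//; exact: Gnd.
have mh n : measurable_fun [set: R] (h n).
  apply/measurable_EFinP.
  by apply: (@measurableT_comp _ _ _ _ _ _ (@powR R ^~ p)).
pose L x := limn (h ^~ x).
have hL n x : (h n x <= L x)%E.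
  apply: lime_ge; first exact: ereal_nondecreasing_is_cvgn.
  by exists n => // m /= nm; exact: hnd.
have mL : measurable_fun [set: R] L.
  apply: (emeasurable_fun_cvg h) => // x _.
  exact: ereal_nondecreasing_is_cvgn.
have L0 x : (0 <= L x)%E by apply: le_trans (hL 0%N x); rewrite lee_fin powR_ge0.
have B0 : 0 <= B.
  rewrite -lee_fin; apply: le_trans (uB set0 _); first exact: Lp_norm_ge0.
  exact: fsets_set0.
have intL : (\int[weight_measure w]_x L x <= (B `^ p)%:E)%E.
  rewrite monotone_convergence//; last first.
    by move=> n x _; rewrite lee_fin powR_ge0.
  apply: lime_le.
    apply: ereal_nondecreasing_is_cvgn => m n mn; apply: ge0_le_integral => //.
    - by move=> x _; rewrite lee_fin powR_ge0.
    - by move=> x _; exact: hnd.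
  apply: nearW => n; have := uB _ (FS n).
  move=> /(gt0_ler_poweR (ltW p0)) => /(_ _ _).
  rewrite !in_itv/= !leey Lp_norm_ge0 lee_fin B0 => /(_ isT isT).
  rewrite (Lp_norm_power _ _ p0).
  apply: le_trans.
  apply: ge0_le_integral => //.
  - by move=> x _; rewrite /h lee_fin powR_ge0.
  - exact: (measurable_normr_powR p (mG n)).
  - by move=> x _; rewrite /h -/(G n x) ger0_norm.
have iL : (weight_measure w).-integrable setT L.
  apply/integrableP; split => //; apply: le_lt_trans (ltry (B `^ p)).
  by under eq_integral do rewrite gee0_abs//.
have good : {ae weight_measure w, forall x, L x \is a fin_num}.
  by apply: filterS (integrable_ae measurableT iL) => x; apply.
have gP x : L x \is a fin_num ->
    [/\ forall n, G n x <= g x, G n x @[n --> \oo] --> g x &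
        ((g x `^ p)%:E <= L x)%E].
  move=> Lx; have Lfin : (0 <= fine (L x))%R by exact: fine_ge0.
  have GL n : G n x <= fine (L x) `^ p^-1.
    have := hL n x; rewrite -(fineK Lx) lee_fin => hLn.
    rewrite -[G n x](powRr1 (G0 n x)) -(mulfV (lt0r_neq0 p0)) powRrM.
    by apply: ge0_ler_powR; rewrite ?nnegrE ?powR_ge0 ?invr_ge0// ltW.
  have GsL : (Gs x <= (fine (L x) `^ p^-1)%:E)%E.
    apply: lime_le; first exact: ereal_nondecreasing_is_cvgn.
    by apply: nearW => n; rewrite lee_fin.
  have Gs0 : (0 <= Gs x)%E by apply: le_trans (GGs 0%N x); rewrite lee_fin.
  have Gsfin : Gs x \is a fin_num.
    by rewrite ge0_fin_numE//; apply: le_lt_trans GsL (ltry _).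
  split.
  - by move=> n; rewrite -lee_fin /g fineK.
  - by apply: (fine_cvg (f := fun n => (G n x)%:E)); rewrite /g fineK.
  - rewrite -(fineK Lx) lee_fin.
    rewrite -[leRHS](powRr1 Lfin) -(mulVf (lt0r_neq0 p0)) powRrM.
    apply: ge0_ler_powR; rewrite ?nnegrE ?powR_ge0 ?(ltW p0) ?fine_ge0//.
    by rewrite -lee_fin /g fineK.
have g0 x : 0 <= g x.
  by apply: fine_ge0; apply: le_trans (GGs 0%N x); rewrite lee_fin.
have igp : (weight_measure w).-integrable setT (fun x => (`|g x| `^ p)%:E).
  apply/integrableP; split; first exact: measurable_normr_powR.
  apply: le_lt_trans (le_lt_trans intL (ltry _)).
  apply: ae_ge0_le_integral => //.
  - by apply: measurableT_comp => //; exact: measurable_normr_powR.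
  - apply: filterS good => x /gP[_ _ gL] _.
    by rewrite gee0_abs ?lee_fin ?powR_ge0// ger0_norm.
have Lg : Lp w p g.
  apply/LpE; split => //; rewrite Lp_norm_root//; apply: poweR_lty.
  have [_] := integrableP _ _ _ igp; apply: le_lt_trans.
  by under eq_integral do rewrite -[X in X%:E]ger0_norm ?powR_ge0//.
have tail : (\int[weight_measure w]_x (`|g x - G n x| `^ p)%:E)%E @[n --> \oo] -->
    0%E.
  have cvg0 : {ae weight_measure w, forall x, [set: R] x ->
      (`|g x - G n x| `^ p)%:E @[n --> \oo] --> 0%E}.
    apply: filterS good => x /gP[_ Ggx _] _.
    apply: cvg_EFin; first by apply: nearW.
    apply: powR_seq_cvg0 => //.
    rewrite -(normr0 R); apply: cvg_norm; rewrite -(subrr (g x)).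
    by apply: cvgB => //; exact: cvg_cst.
  have dom : {ae weight_measure w, forall x n, [set: R] x ->
      (`|(`|g x - G n x| `^ p)%:E| <= (`|g x| `^ p)%:E)%E}.
    apply: filterS good => x /gP[Ggx _ _] n _.
    rewrite gee0_abs ?lee_fin ?powR_ge0//.
    apply: ge0_ler_powR; rewrite ?nnegrE ?(ltW p0)//.
    rewrite !ger0_norm ?subr_ge0//.
    by rewrite lerBlDr lerDl.
  have mgG n : measurable_fun [set: R] (fun x => (`|g x - G n x| `^ p)%:E).
    by apply: measurable_normr_powR; exact: measurable_funB.
  have [_ _] := dominated_convergence measurableT mgG (measurable_cst 0%E)
    cvg0 igp dom.
  by rewrite integral0.
exists g; split => // e e0.
have [n Hn] : exists n, (Lp_norm w p (fun x => (g x - G n x)%R) < e%:E)%E.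
  have ep0 : 0 < e `^ p by rewrite powR_gt0.
  move/fine_cvgP : tail => [tfin /cvgrPdist_lt /(_ _ ep0) tlt].
  have [n [nfin]] := filter_ex (filterI tfin tlt).
  set t := (\int[_]_x _)%E in nfin *; rewrite /= -/t => nlt; exists n.
  have t0 : (0 <= t)%E by apply: integral_ge0 => x _; rewrite lee_fin powR_ge0.
  rewrite Lp_norm_root// -/t -(fineK nfin) poweR_EFin lte_fin.
  rewrite -[ltRHS](powRr1 (ltW e0)) -(mulfV (lt0r_neq0 p0)) powRrM.
  apply: gt0_ltr_powR; rewrite ?invr_gt0 ?nnegrE ?fine_ge0 ?powR_ge0//.
  by apply: le_lt_trans nlt; rewrite sub0r normrN ler_norm.
exists (F n); first exact: FS.
move=> K [finK KS] FnK; apply: le_lt_trans Hn.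
have mK : measurable_fun [set: R] (fun x => \sum_(I \in K) u I x).
  by apply: measurable_fsum => // I /KS; exact: mu.
apply: Lp_norm_ae_le => //; try exact: measurable_funB.
apply: filterS good => x /gP[Ggx _ _].
have [m Km] := Fex _ (conj finK KS).
have [fm fmS] := FS m; have [fn fnS] := FS n.
have KG : \sum_(I \in K) u I x <= g x.
  by apply: le_trans (Ggx m); apply: fsum_subset_le => // I /fmS/u0.
have GK : G n x <= \sum_(I \in K) u I x.
  by apply: fsum_subset_le => // I /KS/u0.
by rewrite !ger0_norm ?subr_ge0 ?lerB// (le_trans GK).
Qed.

End unconditional_sums.

(** * Sparse operators and operator norms *)

Section sparse_operators.
Context {R : realType}.
Variables (D : set (set R)) (hD : dyadic_grid D).
Variables (w : weight R) (p : R) (p1 : 1 < p) (hw : Ap_weight D p w).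
Implicit Types (S F A : set (set R)) (u v : set R -> R -> R) (f g h : R -> R).

Let p0 : 0 < p := lt_trans ltr01 p1.

Lemma Lp_sumB A u v g h :
  (forall I, A I -> measurable_fun [set: R] (u I)) ->
  (forall I, A I -> measurable_fun [set: R] (v I)) ->
  Lp_sum w p A u g -> Lp_sum w p A v h ->
  Lp_sum w p A (fun I x => u I x - v I x) (fun x => g x - h x).
Proof.
move=> mu mv [Lg cg] [Lh ch]; split; first exact: LpB (ltW p1) Lg Lh.
have /LpE[mg _] := Lg; have /LpE[mh _] := Lh.
move=> e e0; have e20 : 0 < e / 2 by lra.
have [F [fF FA] HF] := cg _ e20; have [G [fG GA] HG] := ch _ e20.
exists (F `|` G).
  by split; [rewrite finite_setU|move=> I [/FA|/GA]].
move=> H HA FGH; have [fH HsA] := HA.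
have mus : measurable_fun [set: R] (fun x => g x - \sum_(I \in H) u I x).
  by apply: measurable_funB => //; apply: measurable_fsum => // I /HsA; exact: mu.
have mvs : measurable_fun [set: R] (fun x => h x - \sum_(I \in H) v I x).
  by apply: measurable_funB => //; apply: measurable_fsum => // I /HsA; exact: mv.
have -> : (fun x => g x - h x - \sum_(I \in H) (u I x - v I x)) =
    (fun x => (g x - \sum_(I \in H) u I x) - (h x - \sum_(I \in H) v I x)).
  by apply/funext => x; rewrite !fsbig_finite// sumrB; ring.
apply: le_lt_trans (Lp_normB w (ltW p1) mus mvs) _.
rewrite [e]splitr EFinD; apply: lteD.
- by apply: HF => // I FI; apply: FGH; left.
- by apply: HG => // I GI; apply: FGH; right.
Qed.

Lemma eq_Lp_sum A u v g : (forall I x, A I -> u I x = v I x) ->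
  Lp_sum w p A u g -> Lp_sum w p A v g.
Proof.
move=> uv [Lg cg]; split => // e /cg[F0 F0A HF]; exists F0 => // F FA F0F.
have -> : (fun x => g x - \sum_(I \in F) v I x) = (fun x => g x - \sum_(I \in F) u I x).
  apply/funext => x; congr (_ - _); apply: eq_fsbigr => I /set_mem FI.
  by rewrite uv//; apply: FA.2.
exact: HF.
Qed.

Lemma measurable_average_term f I : D I ->
  measurable_fun [set: R] (fun x => average f I * \1_I x).
Proof.
move=> DI; apply: measurable_funM => //; apply: measurable_indic.
exact: (grid_measurable hD).
Qed.

(** Bounds on finite subcollections are uniform, hence pass to the whole
    collection: the series converges unconditionally for the positive and
    negative parts of [f], and the norm of the sum is a limit of norms of
    finite sums. *)
Lemma sparse_operator_norm S (C : R) : S `<=` D -> 0 <= C ->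
  (forall F f, fsets S F -> Lp w p f ->
    (Lp_norm w p (fun x => (\sum_(I \in F) average f I * \1_I x)%R)
     <= C%:E * Lp_norm w p f)%E) ->
  (op_norm w p (sparse_operator w p S) <= C%:E)%E.
Proof.
move=> SD C0 HC.
have [K K0 HK] := grid_Ap hD p1 hw.
have mterm f I : S I -> measurable_fun [set: R] (fun x => average f I * \1_I x).
  by move=> /SD; exact: measurable_average_term.
have pos f : Lp w p f -> (forall x, 0 <= f x) -> exists g, sparse_operator w p S f g.
  move=> Lf f0; have /LpE[_ lf] := Lf.
  apply: (@Lp_sum_nonneg _ w p p1 _ _ (C * fine (Lp_norm w p f))).
  - exact: sub_countable (subset_card_le SD) (grid_countable hD).
  - exact: mterm.
  - move=> I x /SD DI; rewrite mulr_ge0// ?indicE//.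
    by rewrite divr_ge0 ?Rintegral_ge0// ltW// (grid_len_gt0 hD).
  - move=> F FS; rewrite EFinM fineK ?ge0_fin_numE ?Lp_norm_ge0//; exact: HC.
apply: ereal_inf_lbound; exists C => //; split => // f Lf.
have /LpE[mf lf] := Lf.
pose fp x := Num.max (f x) 0; pose fm x := Num.max (- f x) 0.
have mfp : measurable_fun [set: R] fp by exact: measurable_maxr.
have mfm : measurable_fun [set: R] fm.
  by apply: measurable_maxr => //; exact: measurableT_comp.
have fp0 x : 0 <= fp x by rewrite le_max lexx orbT.
have fm0 x : 0 <= fm x by rewrite le_max lexx orbT.
have fE x : f x = fp x - fm x.
  by rewrite /fp /fm /Num.max; case: ltP => h1; case: ltP => h2; lra.
have Lfp : Lp w p fp.
  apply: (Lp_le p0 mfp Lf) => x; rewrite ger0_norm// ge_max ler_norm normr_ge0//.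
have Lfm : Lp w p fm.
  by apply: (Lp_le p0 mfm Lf) => x; rewrite ger0_norm// ge_max normr_ge0 -normrN ler_norm.
have [gp Hp] := pos _ Lfp fp0; have [gm Hm] := pos _ Lfm fm0.
have Hf : sparse_operator w p S f (fun x => gp x - gm x).
  have := Lp_sumB (mterm fp) (mterm fm) Hp Hm.
  apply: eq_Lp_sum => I x /SD DI; rewrite -mulrBl; congr (_ * _).
  rewrite /average -mulrBl -RintegralB//; last 3 first.
  - exact: (grid_measurable hD).
  - exact: (HK _ _ DI Lfp).1.
  - exact: (HK _ _ DI Lfm).1.
  by congr (_ / _); apply: eq_Rintegral => y _; rewrite fE.
have [Lg cg] := Hf; have /LpE[mg _] := Lg.
exists (fun x => gp x - gm x); split => //.
apply/lee_addgt0Pr => e /cg[F [fF FS] HF].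
have mF : measurable_fun [set: R] (fun x => \sum_(I \in F) average f I * \1_I x).
  by apply: measurable_fsum => // I /FS; exact: mterm.
have -> : (fun x => gp x - gm x) = (fun x => \sum_(I \in F) average f I * \1_I x +
    (gp x - gm x - \sum_(I \in F) average f I * \1_I x)).
  by apply/funext => x; rewrite [RHS]addrC subrK.
apply: le_trans (Lp_normD w (ltW p1) mF (measurable_funB mg mF)) _.
by apply: leeD; [exact: HC|apply/ltW; exact: HF].
Qed.

Lemma op_norm_ge0 T : (0 <= op_norm w p T)%E.
Proof. by apply: le_ereal_inf_tmp => _ [C [C0 _] <-]; rewrite lee_fin. Qed.

(** This takes the place of [ratio_bound] when the symbol has norm zero and is
    therefore not among those in the supremum. *)
Lemma op_norm_Lp_sum0 A (u : (R -> R) -> set R -> R -> R) (c : R) : 0 <= c ->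
  (forall f I x, A I -> u f I x = 0) ->
  (op_norm w p (fun f g => Lp_sum w p A (u f) g) <= c%:E)%E.
Proof.
move=> c0 u0; apply: le_trans (_ : 0%E <= _)%E; last by rewrite lee_fin.
apply: ereal_inf_lbound; exists 0 => //; split => // f Lf.
have L0 : Lp w p (fun=> 0).
  by apply/LpE; split; [exact: measurable_cst|rewrite Lp_norm0// ltry].
exists (fun=> 0); split => //; last by rewrite Lp_norm0// mul0e.
split => // e e0; exists set0; first exact: fsets_set0.
move=> F [_ FA] _.
have -> : (fun x => 0 - \sum_(I \in F) u f I x) = (fun=> 0 : R).
  by apply/funext => x; rewrite fsbig1 ?subr0// => I /FA; exact: u0.
by rewrite Lp_norm0.
Qed.

Lemma ratio_bound (T : Type) (O N : T -> \bar R) (P : set T) (a Lambda : R) b :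
  0 <= a -> (ereal_sup [set O c / N c | c in P] <= a%:E)%E -> P b ->
  (0 < N b)%E -> (N b <= Lambda%:E)%E -> (O b <= (a * Lambda)%:E)%E.
Proof.
move=> a0 supa Pb N0 NL.
have : (O b / N b <= a%:E)%E by apply: le_trans supa; apply: ereal_sup_ubound; exists b.
move: N0 NL; case: (N b) => [n| |]//; rewrite lte_fin lee_fin => n0 nL.
rewrite inver gt_eqF// lee_pdivrMr// => /le_trans; apply.
by rewrite -EFinM lee_fin ler_wpM2l.
Qed.

End sparse_operators.

(** * The suprema in the theorem *)

Section suprema.
Context {R : realType}.
Variables (D : set (set R)) (hD : dyadic_grid D).

Lemma carleson_seq (Lambda : R) S F : S `<=` D -> carleson D Lambda S ->
  fsets S F -> forall J, D J ->
  \sum_(I <- finmap.enum_fset (fset_set F) | `[< I `<=` J >]) len I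
    <= Lambda * len J.
Proof.
move=> SD cS [finF FS] J DJ; rewrite -lee_fin EFinM -(grid_leb hD DJ).
apply: le_trans (cS J DJ); apply: esum_ge.
pose G := F `&` [set I | I `<=` J].
have finG : finite_set G by exact: finite_setIl.
exists G; first by split => // I [/FS].
rewrite (fsbig_mkcondr _ F) fsbig_finite// -sumEFin big_mkcond/= big_seq [leRHS]big_seq.
apply: lee_sum => I; rewrite in_fset_set// => /set_mem/FS/SD DI.
case: asboolP => IJ.
  by rewrite mem_set// (grid_leb hD DI).
by rewrite memNset.
Qed.

Lemma bmo_norm_ge0 b : (0 <= bmo_norm D b)%E.
Proof.
have [J [DJ _ _]] := grid_cell hD 0 0.
apply: le_trans (_ : _ <= (\int[leb]_(x in J) `|b x - average b J|%:E) / leb J)%E _.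
  by rewrite mule_ge0 ?inve_ge0 ?integral_ge0.
by apply: ereal_sup_ubound; exists J.
Qed.

Lemma sup_norm_ge0 tau : (0 <= sup_norm D tau)%E.
Proof.
have [J [DJ _ _]] := grid_cell hD 0 0.
apply: (@le_trans _ _ `|tau J|%:E); first by rewrite lee_fin.
by apply: ereal_sup_ubound; exists J.
Qed.

(** Without such a function the suprema over [b] would be those of the empty set,
    namely [-oo].  The indicator of any grid interval will do: it does not
    vanish against the Haar function of the parent. *)
Lemma exists_BMO_neq0 : exists b, BMO D b /\ bmo_norm D b != 0%E.
Proof.
have [I [DI _ _]] := grid_cell hD 0 0.
have rD K : K \in [:: I] -> D K by rewrite inE => /eqP ->.
have rC J : D J -> \sum_(K <- [:: I] | `[< K `<=` J >]) len K <= 1 * len J.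
  move=> DJ; rewrite big_cons big_nil mul1r; case: asboolP => IJ.
    by rewrite addr0; exact: (grid_le_len hD).
  by rewrite ltW// (grid_len_gt0 hD).
have bB := BMO_count_fun hD rD ltr01 rC.
exists (count_fun [:: I]); split => //; apply/eqP => b0.
have [J [DJ IJ lJ]] := grid_parent hD DI.
have lI := grid_len_gt0 hD DI.
have mI : measurable_fun [set: R] (\1_I : R -> R).
  by apply: measurable_indic; exact: (grid_measurable hD).
have := bmo_norm0_pairing hD (measurable_count_fun hD rD) DJ
  (integrable_count_fun hD rD DJ) b0.
have [e e2 hE] := haar_child hD DI DJ IJ lJ.
rewrite (pairing_count_fun hD rD)// big_seq1.
rewrite (pairing_haar hD DI DJ IJ mI (integrable_indic_grid hD DI DJ) hE).
rewrite !(Rintegral_indic_grid hD DI)//.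
have -> : 2 * len I - len I = len I by ring.
apply/eqP; apply: mulf_neq0; last by rewrite gt_eqF.
apply: mulf_neq0; last by rewrite invr_neq0// gt_eqF// sqrtr_gt0 (grid_len_gt0 hD DJ).
by apply/eqP => e0; move: e2; rewrite e0 expr0n/= => /esym/eqP; rewrite oner_eq0.
Qed.

End suprema.

Theorem mainTheorem4 (R : realType) (D : set (set R)) (hD : dyadic_grid D)
    (p : R) (hp : 1 < p) (w : weight R) (hw : Ap_weight D p w)
    (Lambda : R) (hLambda : 1 < Lambda) :
  (ereal_sup [set op_norm w p (sparse_operator w p S) / Lambda%:E | S in
      [set S : set (set R) | [/\ S `<=` D, carleson D Lambda S &
                                 ~ infinitely_increasing_chain S]]]
   <= ereal_sup [set op_norm w p (paraproduct w p D b) / bmo_norm D b | b in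
        [set b : R -> R | BMO D b /\ bmo_norm D b != 0]]
    + ereal_sup [set op_norm w p (adjoint_paraproduct w p D b) / bmo_norm D b
        | b in [set b : R -> R | BMO D b /\ bmo_norm D b != 0]]
    + ereal_sup [set op_norm w p (martingale_transform w p D tau)
                     / sup_norm D tau | tau in
        [set tau : set R -> R |
          (sup_norm D tau < +oo)%E /\ exists2 J, D J & tau J != 0%R]])%E.
Proof.
have L0 : 0 < Lambda by exact: lt_trans hLambda.
have [J0 [DJ0 _ _]] := grid_cell hD 0 0.
have [b0 Hb0] := exists_BMO_neq0 hD.
apply: ge_ereal_sup => _ [S [SD cS _] <-].
set supA := ereal_sup _; set supB := ereal_sup _; set supC := ereal_sup _.
have supA0 : (0 <= supA)%E.
  apply: le_trans (_ : _ <= op_norm w p (paraproduct w p D b0) / bmo_norm D b0)%E _.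
    by rewrite mule_ge0 ?inve_ge0 ?op_norm_ge0 ?(bmo_norm_ge0 hD).
  by apply: ereal_sup_ubound; exists b0.
have supB0 : (0 <= supB)%E.
  apply: le_trans (_ : _ <= op_norm w p (adjoint_paraproduct w p D b0) / bmo_norm D b0)%E _.
    by rewrite mule_ge0 ?inve_ge0 ?op_norm_ge0 ?(bmo_norm_ge0 hD).
  by apply: ereal_sup_ubound; exists b0.
have supC0 : (0 <= supC)%E.
  pose tau (J : set R) : R := 1.
  apply: le_trans (_ : _ <= op_norm w p (martingale_transform w p D tau) / sup_norm D tau)%E _.
    by rewrite mule_ge0 ?inve_ge0 ?op_norm_ge0 ?(sup_norm_ge0 hD).
  apply: ereal_sup_ubound; exists tau => //; split.
    apply: le_lt_trans (ltry 1); apply: ge_ereal_sup => _ [J _ <-].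
    by rewrite lee_fin normr1.
  by exists J0 => //; exact: oner_neq0.
(* An infinite supremum makes the right-hand side infinite, the other two being
   nonnegative; otherwise all three are real numbers a, b and c. *)
have [Ay|Afin] := eqVneq supA +oo%E.
  by rewrite Ay !addye ?leey// -ltNye ?(lt_le_trans _ supB0) ?(lt_le_trans _ supC0).
have [By|Bfin] := eqVneq supB +oo%E.
  rewrite By addey; last by rewrite -ltNye (lt_le_trans _ supA0).
  by rewrite addye ?leey// -ltNye (lt_le_trans _ supC0).
have [Cy|Cfin] := eqVneq supC +oo%E.
  by rewrite Cy addey ?leey// -ltNye (lt_le_trans _ (adde_ge0 supA0 supB0)).
have [a AE] := ge0_neqy_EFin supA0 Afin.
have [b BE] := ge0_neqy_EFin supB0 Bfin.
have [c CE] := ge0_neqy_EFin supC0 Cfin.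
rewrite AE BE CE -!EFinD inver gt_eqF// lee_pdivrMr// -EFinM.
rewrite AE lee_fin in supA0; rewrite BE lee_fin in supB0.
rewrite CE lee_fin in supC0.
apply: (sparse_operator_norm hD hp hw SD).
  by rewrite mulr_ge0 ?addr_ge0// ltW.
move=> F f FS Lf; have [finF FsS] := FS.
pose r := finmap.enum_fset (fset_set F).
have rD I : I \in r -> D I by rewrite in_fset_set// => /set_mem/FsS/SD.
have rC := carleson_seq hD SD cS FS.
under eq_fun do rewrite fsbig_finite//.
rewrite !mulrDl.
have bB := BMO_count_fun hD rD L0 rC.
have bL := bmo_norm_count_fun hD rD L0 rC.
have pair0 : bmo_norm D (count_fun r) = 0%E ->
    forall J, D J -> pairing (count_fun r) (haar J) = 0.
  move=> b00 J DJ; apply: (bmo_norm0_pairing hD) b00 => //.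
    exact: (measurable_count_fun hD).
  exact: (integrable_count_fun hD).
have bpos : bmo_norm D (count_fun r) != 0%E -> (0 < bmo_norm D (count_fun r))%E.
  by move=> bN0; rewrite lt0e bN0 (bmo_norm_ge0 hD).
apply: (finite_sparse_bound hD hp hw rD Lf).
- have [b00|bN0] := eqVneq (bmo_norm D (count_fun r)) 0%E.
    apply: (op_norm_Lp_sum0 w hp (u := fun f I x =>
      pairing (count_fun r) (haar I) * average f I * haar I x)).
      by rewrite mulr_ge0// ltW.
    by move=> h I x DI; rewrite (pair0 b00 I DI) !mul0r.
  apply: (ratio_bound (O := fun b => op_norm w p (paraproduct w p D b))
    supA0 (N := bmo_norm D) (P := [set b | BMO D b /\ bmo_norm D b != 0%E])) bL; last exact: bpos.
    by rewrite -AE.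
  by split.
- have [b00|bN0] := eqVneq (bmo_norm D (count_fun r)) 0%E.
    apply: (op_norm_Lp_sum0 w hp (u := fun f I x =>
      pairing (count_fun r) (haar I) * pairing f (haar I) * (\1_I x / len I))).
      by rewrite mulr_ge0// ltW.
    by move=> h I x DI; rewrite (pair0 b00 I DI) !mul0r.
  apply: (ratio_bound (O := fun b => op_norm w p (adjoint_paraproduct w p D b))
    supB0 (N := bmo_norm D) (P := [set b | BMO D b /\ bmo_norm D b != 0%E])) bL; last exact: bpos.
    by rewrite -BE.
  by split.
- have [[J DJ tJ]|tau0] := pselect (exists2 J, D J & inner_density r J != 0).
    have tL := sup_norm_inner_density hD rD rC.
    apply: (ratio_bound (O := fun t => op_norm w p (martingale_transform w p D t))
      supC0 (N := sup_norm D) (P := [set t | (sup_norm D t < +oo)%E /\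
        exists2 J, D J & t J != 0])) tL.
    + by rewrite -CE.
    + split; first exact: le_lt_trans (sup_norm_inner_density hD rD rC) (ltry _).
      by exists J.
    + apply: (@lt_le_trans _ _ `|inner_density r J|%:E).
        by rewrite lte_fin normr_gt0.
      by apply: ereal_sup_ubound; exists J.
  apply: (op_norm_Lp_sum0 w hp (u := fun f I x =>
    inner_density r I * pairing f (haar I) * haar I x)).
    by rewrite mulr_ge0// ltW.
  move=> h I x DI; have -> : inner_density r I = 0.
    by apply/eqP/negPn/negP => tI; apply: tau0; exists I.
  by rewrite !mul0r.
Qed.
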